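(* Let $0<d<r$ be constants, let $D'=\{\mathbf x\in\mathbb{R}^n:d<|\mathbf x|<r\}$ and $Y'=\{\mathbf y\in\mathbb{R}^n:d+r<|\mathbf y|<2r\}$. Let $Rf(\mathbf y)=\int_{S(\mathbf y)}f\,dS$, where $S(\mathbf y)=\{\mathbf x\in\mathbb{R}^n:|\mathbf x-\mathbf y|=r\}$ is the sphere of constant radius $r$. Then $Rf(\mathbf y)$ for $\mathbf y\in Y'$ determines $f\in L^2_c(D')$ uniquely.
   Context: $dS$ is surface measure on $S(\mathbf y)$. $L^2_c(D')$ is the space of $L^2$ functions with compact support in $D'$. *)

(* Defs.v *)
From HB Require Import structures.
From mathcomp Require Import all_boot all_order all_algebra.
From mathcomp Require Import all_classical all_reals all_analysis.
From mathcomp Require Import measurable_realfun.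
Import Order.TTheory GRing.Theory Num.Theory.
Import numFieldNormedType.Exports.

Set Implicit Arguments.
Unset Strict Implicit.
Unset Printing Implicit Defensive.

Local Open Scope classical_set_scope.
Local Open Scope ring_scope.

(* The space R^n is 'rV[R]_n. Its topology is the one of the library; the norm
   of the library on matrices is the sup norm, hence [enorm] below. Its
   sigma-algebra is the Borel (product) one, generated by the coordinates. *)

Definition rV_display : measure_display.
Proof. exact: default_measure_display. Qed.

Section rV_measurable.
Context (R : realType) (n : nat).

Let coors (i : 'I_n) (x : 'rV[R]_n) : R := x ord0 i.

Let rV_set0 : g_sigma_preimage coors set0.
Proof. exact: sigma_algebra0. Qed.

Let rV_setC A : g_sigma_preimage coors A -> g_sigma_preimage coors (~` A).
Proof. exact: sigma_algebraC. Qed.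

Let rV_bigcup (F : _^nat) : (forall i, g_sigma_preimage coors (F i)) ->
  g_sigma_preimage coors (\bigcup_i (F i)).
Proof. exact: sigma_algebra_bigcup. Qed.

HB.instance Definition _ := @isMeasurable.Build rV_display
  'rV[R]_n (g_sigma_preimage coors) rV_set0 rV_setC rV_bigcup.

Lemma measurable_coor (i : 'I_n) :
  measurable_fun [set: 'rV[R]_n] (fun x : 'rV[R]_n => x ord0 i).
Proof.
move=> _ Y mY; rewrite setTI; apply: sub_sigma_algebra => /=.
rewrite -bigcup_seq/=; exists i => /=; first by rewrite mem_index_enum.
by exists Y => //; rewrite setTI.
Qed.

Lemma measurable_fun_coor d (T : measurableType d) (f : T -> 'rV[R]_n) :
  (forall i, measurable_fun [set: T] (fun t => f t ord0 i)) ->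
  measurable_fun [set: T] f.
Proof.
move=> mf; apply: (measurability _ (erefl (g_sigma_preimage coors))).
move=> _ [B + <-]; rewrite -bigcup_seq => -[i _ [C mC <-]].
by rewrite !setTI -comp_preimage -[X in measurable X]setTI; exact: mf.
Qed.

End rV_measurable.

(* [pushforward] along a bundled measurable function, so that its measure
   structure is inferred (cf. [distribution] for probability measures). *)
Section mpushforward.
Context d d' (T : measurableType d) (T' : measurableType d') (R : realType).
Variables (m : {measure set T -> \bar R}) (f : {mfun T >-> T'}).

Definition mpushforward : set T' -> \bar R := pushforward m f.

Let mpushforward0 : mpushforward set0 = 0%E.
Proof. exact: measure0. Qed.

Let mpushforward_ge0 A : (0 <= mpushforward A)%E.
Proof. exact: measure_ge0. Qed.

Let mpushforward_sigma_additive : semi_sigma_additive mpushforward.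
Proof. exact: measure_semi_sigma_additive. Qed.

HB.instance Definition _ := isMeasure.Build _ _ _ mpushforward
  mpushforward0 mpushforward_ge0 mpushforward_sigma_additive.

End mpushforward.

Section lebesgue_rV.
Context (R : realType).

Definition rV_cons (n : nat) (p : measurableTypeR R * 'rV[R]_n) : 'rV[R]_n.+1 :=
  row_mx (p.1%:M : 'rV[R]_1) p.2.

Definition rV_uncons (n : nat) (x : 'rV[R]_n.+1) : measurableTypeR R * 'rV[R]_n :=
  (x ord0 ord0, rsubmx (x : 'rV[R]_(1 + n))).

Lemma rV_consK n : cancel (@rV_cons n) (@rV_uncons n).
Proof.
move=> [t x]; rewrite /rV_uncons /rV_cons row_mxKr; congr (_, _).
transitivity (row_mx (t%:M : 'rV[R]_1) x ord0 (lshift n ord0)).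
  by congr (row_mx _ _ _ _); exact: val_inj.
by rewrite row_mxEl mxE mulr1n.
Qed.

Lemma measurable_rV_cons n : measurable_fun setT (@rV_cons n).
Proof.
apply: measurable_fun_coor => i.
have [j ->|j ->] := split_ordP (i : 'I_(1 + n)).
  rewrite (_ : (fun t => _) = fst); first exact: measurable_fst.
  apply/funext => t; apply: etrans (row_mxEl _ _ _ _) _.
  by rewrite mxE !ord1 eqxx mulr1n.
rewrite (_ : (fun t => _) = (fun x : 'rV[R]_n => x ord0 j) \o snd).
  by apply: measurableT_comp; [exact: measurable_coor|exact: measurable_snd].
by apply/funext => t; exact: row_mxEr.
Qed.

HB.instance Definition _ n := isMeasurableFun.Build _ _ _ _ (@rV_cons n)
  (@measurable_rV_cons n).

Lemma measurable_rV_uncons n : measurable_fun setT (@rV_uncons n).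
Proof.
apply/measurable_fun_pair; first exact: measurable_coor.
apply: measurable_fun_coor => i.
rewrite (_ : (fun t => _) = (fun x : 'rV[R]_(1 + n) => x ord0 (rshift 1 i))).
  exact: measurable_coor.
by apply/funext => t; rewrite mxE.
Qed.

Section step.
Context (n : nat) (m : {sigma_finite_measure set 'rV[R]_n -> \bar R}).

Definition lebesgue_rV_step : set 'rV[R]_n.+1 -> \bar R :=
  mpushforward (lebesgue_measure \x m)%E (@rV_cons n).

HB.instance Definition _ := Measure.on lebesgue_rV_step.

Let step_sigma_finite : sigma_finite setT lebesgue_rV_step.
Proof.
have /sigma_finiteP[F [UF ndF Foo]] := sigma_finiteT (@lebesgue_measure R).
have /sigma_finiteP[G [UG ndG Goo]] := sigma_finiteT m.
exists (fun i => @rV_uncons n @^-1` (F i `*` G i)).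
  apply/esym/seteqP; split => // x _; set p := rV_uncons x.
  have [i _ Fi] : (\bigcup_i F i) p.1 by rewrite -UF.
  have [j _ Gj] : (\bigcup_i G i) p.2 by rewrite -UG.
  exists (maxn i j) => //; split.
    by move: Fi; exact/subsetPset/ndF/leq_maxl.
  by move: Gj; exact/subsetPset/ndG/leq_maxr.
move=> i; have [mF Fi] := Foo i; have [mG Gi] := Goo i; split.
  rewrite -[X in measurable X]setTI; apply: measurable_rV_uncons => //.
  exact: measurableX.
rewrite /lebesgue_rV_step /mpushforward /pushforward -comp_preimage.
rewrite (_ : _ \o _ = id) ?preimage_id; last first.
  by apply/funext => x /=; rewrite rV_consK.
by rewrite /= product_measure1E// lte_mul_pinfty// ge0_fin_numE.
Qed.

HB.instance Definition _ := Measure_isSigmaFinite.Build _ _ _ lebesgue_rV_step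
  step_sigma_finite.

End step.

(* Lebesgue measure on R^n: the n-fold product of [lebesgue_measure]. *)
Fixpoint lebesgue_rV (n : nat) : {sigma_finite_measure set 'rV[R]_n -> \bar R} :=
  match n with
  | 0 => dirac (0 : 'rV[R]_0)
  | n.+1 => lebesgue_rV_step (lebesgue_rV n)
  end.

End lebesgue_rV.
Arguments lebesgue_rV {R n}.

Definition enorm (R : realType) (n : nat) (x : 'rV[R]_n) : R :=
  Num.sqrt (\sum_(i < n) x ord0 i ^+ 2).

Definition sphere (R : realType) (n : nat) (r : R) (y : 'rV[R]_n) :
  set 'rV[R]_n := [set x | enorm (x - y) = r].

Definition annulus (R : realType) (n : nat) (a b : R) : set 'rV[R]_n :=
  [set x | a < enorm x < b].
Arguments annulus {R n}.

Section surface_measure.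
Context (R : realType) (n : nat).

Lemma measurable_enorm : measurable_fun setT (@enorm R n).
Proof.
apply: (@measurableT_comp _ _ _ _ _ _ (@Num.sqrt R)).
  by apply: continuous_measurable_fun; exact: sqrt_continuous.
apply: measurable_sum => i.
by apply: measurable_funX; exact: measurable_coor.
Qed.

Definition punctured_ball : set 'rV[R]_n := [set x | 0 < enorm x < 1].

Lemma measurable_punctured_ball : measurable punctured_ball.
Proof.
rewrite (_ : punctured_ball = setT `&` @enorm R n @^-1` `]0, 1[%classic).
  by apply: measurable_enorm.
by rewrite setTI; apply/seteqP; split => x /=; rewrite in_itv.
Qed.

Definition normalize (x : 'rV[R]_n) : 'rV[R]_n := (enorm x)^-1 *: x.

Lemma measurable_normalize : measurable_fun setT normalize.
Proof.
have minv : measurable_fun setT (@GRing.inv R).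
  rewrite -(setUv [set 0 : R]); apply/measurable_funU => //.
    exact: measurableC.
  split; first exact: measurable_fun_set1.
  apply: open_continuous_measurable_fun.
    by apply: closed_openC; exact: closed_eq.
  by move=> x; rewrite inE /= => /eqP x0; exact: inv_continuous.
apply: measurable_fun_coor => i.
rewrite (_ : (fun t => _) = (fun x => (enorm x)^-1 * x ord0 i)).
  apply: measurable_funM; last exact: measurable_coor.
  exact: (measurableT_comp minv measurable_enorm).
by apply/funext => x; rewrite mxE.
Qed.

HB.instance Definition _ := isMeasurableFun.Build _ _ _ _ normalize
  measurable_normalize.

(* Surface measure of the unit sphere, as in the polar coordinates formula:
   sigma(E) = n * Leb {t w | 0 < t < 1, w in E}. *)
Definition unit_sphere_measure : {measure set 'rV[R]_n -> \bar R} :=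
  mscale (n%:R)%:nng
    (mpushforward (mrestr lebesgue_rV measurable_punctured_ball) normalize).

Definition dilate (r : R) (y w : 'rV[R]_n) : 'rV[R]_n := y + r *: w.

Lemma measurable_dilate (r : R) (y : 'rV[R]_n) :
  measurable_fun setT (dilate r y).
Proof.
apply: measurable_fun_coor => i.
rewrite (_ : (fun t => _) = (fun x : 'rV[R]_n => y ord0 i + r * x ord0 i)).
  by apply: measurable_funD => //; apply: measurable_funM => //;
    exact: measurable_coor.
by apply/funext => x; rewrite !mxE.
Qed.

HB.instance Definition _ (r : R) (y : 'rV[R]_n) :=
  isMeasurableFun.Build _ _ _ _ (dilate r y) (measurable_dilate r y).

(* Surface measure dS of [sphere r y], meaningful for r > 0 (the absolute value
   only serves to have a nonnegative scaling factor). *)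
Definition sphere_measure (r : R) (y : 'rV[R]_n) :
    {measure set 'rV[R]_n -> \bar R} :=
  mscale (`|r| ^+ n.-1)%:nng (mpushforward unit_sphere_measure (dilate r y)).

End surface_measure.

(* Integral over the sphere of fixed radius r; for f in L^2 with compact support
   it is finite for almost every y only. *)
Definition spherical_transform (R : realType) (n : nat) (r : R)
    (f : 'rV[R]_n -> R) (y : 'rV[R]_n) : \bar R :=
  (\int[sphere_measure r y]_(x in sphere r y) (f x)%:E)%E.

(* Square-integrable functions on R^n with (essential) support a compact subset
   of D. Functions are representatives of classes modulo equality a.e. *)
Definition L2c (R : realType) (n : nat) (D : set 'rV[R]_n) :
    set ('rV[R]_n -> R) :=
  [set f | f \in Lfun lebesgue_rV 2%:E /\
    exists K, [/\ compact K, K `<=` D &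
      {ae lebesgue_rV, forall x, ~ K x -> f x = 0}]].

(* Main.v *)
(** By linearity let [h = f - g], which vanishes outside [d < |x| < r].  If
    [|v| d < 1] then every center [y] with [|y| > d + r] sees a vanishing
    spherical mean, so the Laplace transform of [h], which is the one of its
    spherical mean divided by that of the sphere, satisfies
    [int h(x) e^(xi.x) e^(tau v.x) dx = O(e^(b tau))] for every [xi] and some
    [b < 1]: on [|y| <= d + r] the exponent [tau v.y] is at most
    [tau |v| (d + r)], while the transform of the sphere is at least of order
    [e^(tau (r |v| - eps))].  A Mikusinski-type lemma then gives
    [int_(v.x > 1) h(x) e^(xi.x) dx = 0] for all [xi], hence [h = 0] a.e. on
    [v.x > 1] by injectivity of the Laplace transform, and countably many such
    half-spaces cover [|x| > d]. *)
From HB Require Import structures.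
Require Import Defs.
From mathcomp Require Import all_boot all_order all_algebra.
From mathcomp Require Import all_classical all_reals all_analysis.
From mathcomp Require Import measurable_realfun ring lra.
Import Order.TTheory GRing.Theory Num.Theory.
Import numFieldNormedType.Exports.

Local Open Scope classical_set_scope.
Local Open Scope ring_scope.

Set Implicit Arguments.
Unset Strict Implicit.
Unset Printing Implicit Defensive.

(** * Tails of measures with small exponential moments *)

(** The rate [b] comes from a cancellation: small centers let the transform grow at rate
    [|v| (d + r)], while the sphere itself reaches the distance [r] in every direction, so division
    removes [r |v|] and leaves [d |v| + eps], below the threshold 1. This is why real exponentials
    are used: a growth rate locates a half-space. The extra [xi] is carried along because a single
    vanishing tail integral says little, whereas vanishing for all [xi] says that the truncated
    function has zero Laplace transform. Injectivity comes from the same tail lemma: a function with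
    zero transform keeps it after truncation to a coordinate half-space; the sets whose truncation
    has this effect form a sigma-algebra, so one may truncate to the set where the function is
    positive, and the transform at 0 yields the integral of the absolute value. The obstacle is that
    an integrable function need not be integrable over every sphere, and that it may be changed on a
    null set. Surface integrals are therefore pulled back to the punctured ball, a domain
    independent of the center, where Fubini disposes of the exceptional centers. *)

Lemma bernoulli_le (R : realType) (m : nat) (a : R) :
  0 <= a <= 1 -> 1 - m%:R * a <= (1 - a) ^+ m.
Proof.
move=> /andP[a0 a1]; elim: m => [|m IH]; first by rewrite mul0r subr0 expr0.
rewrite exprS -natr1.
apply: (@le_trans _ _ ((1 - a) * (1 - m%:R * a))); last first.
  by rewrite ler_wpM2l// subr_ge0.
have : 0 <= m%:R * a * a by rewrite !mulr_ge0.
lra.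
Qed.

Lemma expn_le_expR (R : realType) (m : nat) (q : R) : (0 < m)%N ->
  - m%:R <= q -> (1 + q / m%:R) ^+ m <= expR q.
Proof.
move=> m0 mq; have m0' : 0 < m%:R :> R by rewrite ltr0n.
rewrite [leRHS](_ : _ = expR (m%:R * (q / m%:R))); last first.
  by rewrite mulrC divfK ?gt_eqF.
rewrite expRM_natl.
rewrite lerXn2r ?nnegrE ?expR_ge0 ?expR_ge1Dx//.
rewrite -(@ler_pM2r _ m%:R)// mul0r mulrDl mul1r divfK ?gt_eqF//.
by rewrite addrC -lerBlDr sub0r.
Qed.

Lemma measurable_lt_fun d (T : measurableType d) (R : realType) (u : T -> R)
    (t : R) : measurable_fun setT u -> measurable [set x | t < u x].
Proof.
move=> mu; rewrite (_ : [set x | _] = setT `&` u @^-1` `]t, +oo[%classic).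
  exact: mu.
by rewrite setTI; apply/seteqP; split => x /=; rewrite in_itv/= andbT.
Qed.

Lemma integrable_scale d (T : measurableType d) (R : realType)
    (mu : {measure set T -> \bar R}) (a : R) (f : T -> R) :
  mu.-integrable setT (EFin \o f) ->
  mu.-integrable setT (EFin \o (fun x => a * f x)).
Proof. exact: integrableZl. Qed.

Section laplace_kernel.
Context d (T : measurableType d) (R : realType) (mu : {measure set T -> \bar R}).
Variables (k u : T -> R) (M : R).
Hypotheses (ik : mu.-integrable setT (EFin \o k)) (mu_u : measurable_fun setT u).
Hypothesis kM : forall x, k x != 0 -> u x <= M.

Let mk : measurable_fun setT k.
Proof. by apply/measurable_EFinP; exact: measurable_int ik. Qed.

Lemma integrable_mul_expR (N : R) : 0 <= N ->
  mu.-integrable setT (EFin \o (fun x => k x * expR (N * u x))).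
Proof.
move=> N0; apply: (@le_integrable _ _ _ _ _ measurableT _
    (EFin \o (fun x => expR (N * M) * k x))).
- apply/measurable_EFinP; apply: measurable_funM => //.
  by apply: measurableT_comp => //; apply: measurable_funM.
- move=> x _ /=; rewrite lee_fin !normrM mulrC.
  have [->|k0] := eqVneq (k x) 0; first by rewrite normr0 !mulr0.
  rewrite ler_wpM2r// !ger0_norm ?expR_ge0// ler_expR.
  by rewrite ler_wpM2l// kM.
- exact: integrable_scale.
Qed.

Lemma Rintegral_sum (I : Type) (s : seq I) (f : I -> T -> R) :
  (forall i, mu.-integrable setT (EFin \o f i)) ->
  \int[mu]_x (\sum_(i <- s) f i x) = \sum_(i <- s) \int[mu]_x f i x.
Proof.
move=> intf; rewrite /Rintegral.
under eq_integral do rewrite -sumEFin.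
rewrite (@integral_sum _ _ _ mu setT measurableT _ (fun i => EFin \o f i))//.
rewrite -sum_fine// => i _; exact: integrable_fin_num.
Qed.

(* The kernel [(1 - w/m)^m] expands into exponentials of [u] with constant term
   [1]; all the others are controlled by the hypothesis on the transform. *)
Lemma laplace_kernel_le (C b s : R) (L m : nat) : (0 < m)%N -> 0 <= C ->
  (forall N : nat, `|\int[mu]_x (k x * expR (N%:R * u x))|
     <= C * expR (N%:R * b)) ->
  `|\int[mu]_x (k x * (1 - expR (L%:R * u x - s) / m%:R) ^+ m)
     - \int[mu]_x k x| <= C * (expR (expR (L%:R * b - s)) - 1).
Proof.
move=> m0 C0 H; pose w z : R := expR (L%:R * z - s).
rewrite -/(w b); under eq_Rintegral do rewrite -/(w (u _)).
pose c (j : nat) : R := (- m%:R^-1) ^+ j *+ 'C(m, j) * expR (j%:R * - s).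
have wE (j : nat) z : w z ^+ j = expR (j%:R * - s) * expR ((j * L)%:R * z).
  by rewrite /w -expRM_natl -expRD; congr expR; rewrite natrM; ring.
have E x : k x * (1 - w (u x) / m%:R) ^+ m =
    \sum_(j < m.+1) c j * (k x * expR ((j * L)%:R * u x)).
  rewrite exprDn mulr_sumr; apply: eq_bigr => j _.
  rewrite expr1n mul1r -mulrN exprMn wE /c.
  move: ((- _) ^+ j) (k x) 'C(m, j) (expR _) (expR _) => p q y z t; ring.
have i1 j :
    mu.-integrable setT (EFin \o (fun x => k x * expR ((j * L)%:R * u x))).
  by apply: integrable_mul_expR.
under eq_Rintegral do rewrite E.
rewrite Rintegral_sum; last first.
  by move=> i; exact: integrable_scale.
under eq_bigr => i _ do rewrite RintegralZl//.
rewrite big_ord_recl.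
have -> : c (@ord0 m) = 1 by rewrite /c expr0 bin0 mul0r expR0 mulr1.
rewrite mul1r [X in X + _ - _](_ : _ = \int[mu]_x k x); last first.
  by apply: eq_Rintegral => x _; rewrite mul0n mul0r expR0 mulr1.
rewrite addrAC subrr add0r (le_trans (ler_norm_sum _ _ _))//.
(* In absolute value the terms resum to [(1 + w b / m) ^+ m], so the bound is uniform in [m]. *)
have mw : 1 + \sum_(i < m) `|c (lift ord0 i)| * expR ((lift ord0 i * L)%:R * b)
    <= expR (w b).
  apply: le_trans (@expn_le_expR R m (w b) m0 _); last first.
    by rewrite (@le_trans _ _ 0)// ?oppr_le0 ?ler0n ?expR_ge0.
  rewrite exprDn big_ord_recl subn0 !expr1n expr0 mulr1 bin0 mulr1n lerD2l.
  apply: ler_sum => i _.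
  rewrite expr1n mul1r exprMn wE /c normrM normrMn normrX normrN.
  rewrite (ger0_norm (expR_ge0 _)) ger0_norm ?invr_ge0 ?ler0n//.
  rewrite le_eqVlt; apply/orP; left; apply/eqP.
  move: (m%:R^-1 ^+ _) 'C(m, _) (expR _) (expR _) => p q y z; ring.
apply: (@le_trans _ _ (C * \sum_(i < m)
    `|c (lift ord0 i)| * expR ((lift ord0 i * L)%:R * b))); last first.
  by rewrite ler_wpM2l// lerBrDl.
rewrite mulr_sumr ler_sum// => i _; rewrite normrM mulrCA ler_wpM2l//.
Qed.

End laplace_kernel.

Section laplace_tail.
Context d (T : measurableType d) (R : realType) (mu : {measure set T -> \bar R}).

Lemma dominated_cvg_Rintegral (h : (T -> R)^nat) (k l : T -> R) :
  mu.-integrable setT (EFin \o k) -> (forall N, measurable_fun setT (h N)) ->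
  measurable_fun setT l -> (forall N x, `|h N x| <= `|k x|) ->
  (forall x, h ^~ x @ \oo --> l x) ->
  \int[mu]_x h N x @[N --> \oo] --> \int[mu]_x l x.
Proof.
move=> ik mh ml hk hl.
have [||||| il _ hcv] := @dominated_convergence _ _ _ mu setT measurableT
  (fun N => EFin \o h N) (EFin \o l) (abse \o (EFin \o k)).
- by move=> N; exact/measurable_EFinP.
- exact/measurable_EFinP.
- by apply: aeW => x _ /=; apply/fine_cvgP; split; [exact: nearW|exact: hl].
- exact: integrable_abse.
- by apply: aeW => x N _ /=; rewrite lee_fin.
apply: fine_cvg; rewrite fineK//; exact: integrable_fin_num.
Qed.

Variables (k u : T -> R) (M C b t : R).
Hypotheses (ik : mu.-integrable setT (EFin \o k)) (mu_u : measurable_fun setT u).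
Hypothesis kM : forall x, k x != 0 -> u x <= M.
Hypothesis bt : b < t.
Hypothesis kC : forall N : nat,
  `|\int[mu]_x (k x * expR (N%:R * u x))| <= C * expR (N%:R * b).

Let mk : measurable_fun setT k.
Proof. by apply/measurable_EFinP; exact: measurable_int ik. Qed.

(** As [N] grows this tends to infinity for [z > t] and to 0 for [z <= t]: the term [- N] settles
    the boundary [z = t], and the square is there to beat it when [z > t]. The coefficient of [z] is
    a natural number because [kC] is known only for such exponents. *)
Let w (N : nat) z : R := expR ((N * N)%:R * z - ((N * N)%:R * t + N%:R)).
(** Exceeds [w N M], the largest possible value of [w N (u x)] where [k] is nonzero, so that the
    base [1 - w / m] stays in [0, 1] and [|k|] dominates. *)
Let m (N : nat) : nat := (Num.trunc (w N M)).+1.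

Let wE N z : w N z = expR ((N * N)%:R * (z - t) - N%:R).
Proof. by rewrite /w; congr expR; ring. Qed.

Let w_le N z : z <= t -> w N z <= expR (- N%:R).
Proof.
move=> zt; rewrite wE ler_expR gerDr.
by rewrite mulr_ge0_le0// subr_le0.
Qed.

Let w_ge N z : 0 < z - t -> 2 <= N%:R * (z - t) -> N%:R <= w N z.
Proof.
move=> zt hN; rewrite wE (le_trans _ (expR_ge1Dx _))//.
have : N%:R * 2 <= N%:R * (N%:R * (z - t)) by rewrite ler_wpM2l.
by rewrite natrM; lra.
Qed.

Let kernel01 N x : k x != 0 -> 0 <= w N (u x) / (m N)%:R <= 1.
Proof.
move=> k0; have m0 : 0 < (m N)%:R :> R by rewrite ltr0n.
rewrite divr_ge0 ?expR_ge0//= ler_pdivrMr// mul1r.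
apply: (@le_trans _ _ (w N M)); last exact/ltW/truncnS_gt.
by rewrite ler_expR lerD2r ler_wpM2l// kM.
Qed.

(** The kernel [(1 - w / m) ^+ m] behaves like [expR (- w)] and tends to the indicator of
    [u x <= t], so its integral against [k] tends to that of [k] over this set. By
    [laplace_kernel_le] the same integral tends to that of all of [k], since [w N b] tends to 0. The
    difference of the two limits is the tail. *)
Lemma laplace_tail : \int[mu]_(x in [set x | t < u x]) k x = 0.
Proof.
have mA : measurable [set x | t < u x] by exact: measurable_lt_fun.
pose l x := k x - (k \_ [set x | t < u x]) x.
have ml : measurable_fun setT l.
  apply: measurable_funB => //; apply/measurable_restrict => //.
  by rewrite setTI; exact: measurable_funS mk.
pose h N x := k x * (1 - w N (u x) / (m N)%:R) ^+ m N.
have mh N : measurable_fun setT (h N).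
  apply: measurable_funM => //; apply: measurable_funX.
  apply: measurable_funB => //; apply: measurable_funM => //.
  apply: (measurableT_comp _ mu_u); rewrite /w.
  apply: measurableT_comp => //; apply: measurable_funB => //.
have P01 N x : k x != 0 -> 0 <= (1 - w N (u x) / (m N)%:R) ^+ m N <= 1.
  move=> /(kernel01 N) /andP[? ?]; rewrite exprn_ge0 ?subr_ge0//=.
  by rewrite exprn_ile1 ?subr_ge0// gerBl.
have hk N x : `|h N x| <= `|k x|.
  rewrite /h normrM; have [->|/(P01 N) /andP[? ?]] := eqVneq (k x) 0.
    by rewrite normr0 mul0r.
  by rewrite ler_piMr// ger0_norm.
have hl x : h ^~ x @ \oo --> l x.
  rewrite /l /h patchE; have [->|k0] := eqVneq (k x) 0.
    rewrite if_same subr0; under eq_fun do rewrite mul0r; exact: cvg_cst.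
  have [/set_mem/= tu|/negP ut] := boolP (x \in _).
    rewrite subrr -[X in _ --> X](mulr0 (k x)).
    apply: cvgM; first exact: cvg_cst.
    apply: (@squeeze_cvgr _ _ _ _ (cst 0) (fun N => expR (- N%:R))); last 2 first.
    - exact: cvg_cst.
    - exact: cvgn_expR.
    near=> N; have /andP[-> _] /= := P01 N _ k0.
    apply: (@le_trans _ _ (expR (- w N (u x)))).
      rewrite -mulNr; apply: expn_le_expR => //.
      rewrite lerN2; have /andP[_] := kernel01 N k0.
      by rewrite ler_pdivrMr ?mul1r// ltr0n.
    rewrite ler_expR lerN2 w_ge// ?subr_gt0// -ler_pdivrMr ?subr_gt0//.
    by near: N; exact: nbhs_infty_ger.
  rewrite subr0 -[X in _ --> X](mulr1 (k x)).
  apply: cvgM; first exact: cvg_cst.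
  have {}ut : u x <= t by rewrite leNgt; apply/negP => tu; apply: ut; rewrite inE.
  apply: (@squeeze_cvgr _ _ _ _ (fun N => 1 - expR (- N%:R)) (cst 1)); last 2 first.
  - rewrite -[X in _ --> X]subr0; apply: cvgB; first exact: cvg_cst.
    exact: cvgn_expR.
  - exact: cvg_cst.
  near=> N; have /andP[_ ->] := P01 N _ k0; rewrite andbT.
  apply: le_trans (bernoulli_le _ (kernel01 N k0)).
  by rewrite lerB// mulrC divfK ?pnatr_eq0// w_le.
have := dominated_cvg_Rintegral ik mh ml hk hl.
have C0 : 0 <= C.
  by have := le_trans (normr_ge0 _) (kC 0); rewrite mul0r expR0 mulr1.
have hb N : `|\int[mu]_x h N x - \int[mu]_x k x| <= C * expR 1 * expR (- N%:R).
  have := @laplace_kernel_le _ _ _ mu _ _ _ ik mu_u kM C b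
    ((N * N)%:R * t + N%:R) (N * N) (m N) isT C0 kC.
  move=> /le_trans; apply.
  rewrite -/(w _ _) -mulrA ler_wpM2l//.
  set q := w N b.
  have q0 : 0 <= q by exact: expR_ge0.
  have q1 : q <= expR (- N%:R) by apply: w_le; exact: ltW.
  (* [expR q - 1 <= q * expR q] is [1 - q <= expR (- q)] multiplied by [expR q]. *)
  apply: (@le_trans _ _ (expR q * q)).
    have := expR_ge1Dx (- q); rewrite -(ler_pM2l (expR_gt0 q)) -expRD subrr expR0.
    lra.
  rewrite ler_pM ?expR_ge0// ler_expR (le_trans q1)// -[leRHS]expR0 ler_expR.
have kcv : \int[mu]_x h N x @[N --> \oo] --> \int[mu]_x k x.
  apply/cvgrPdist_le => e e0.
  have : C * expR 1 * expR (- N%:R) @[N --> \oo] --> C * expR 1 * 0.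
    apply: cvgM; first exact: cvg_cst.
    exact: cvgn_expR.
  rewrite mulr0 => /cvgr0Pnorm_le/(_ _ e0); apply: filterS => N.
  rewrite distrC; apply: le_trans; apply: le_trans (hb N) _; exact: ler_norm.
move=> /(cvg_unique (@norm_hausdorff _ _) kcv).
rewrite /l RintegralB//; last first.
  rewrite -[X in _.-integrable _ X]/(EFin \o (k \_ _)) -restrict_EFin.
  apply/(integrable_mkcond _ mA); exact: integrableS ik.
rewrite -Rintegral_mkcond; lra.
Unshelve. all: by end_near. Qed.

End laplace_tail.

(** * Injectivity of the Laplace transform *)

Lemma integrable_patch d (T : measurableType d) (R : realType)
    (mu : {measure set T -> \bar R}) (A : set T) (k : T -> R) : measurable A ->
  mu.-integrable setT (EFin \o k) -> mu.-integrable setT (EFin \o (k \_ A)).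
Proof.
move=> mA ik; rewrite -restrict_EFin.
by apply/(integrable_mkcond _ mA); exact: integrableS ik.
Qed.

Lemma patchME (T : Type) (R : realType) (A : set T) (k e : T -> R) :
  (fun x => (k \_ A) x * e x) = (fun x => k x * e x) \_ A.
Proof. by apply/funext => x; rewrite !patchE; case: ifP => // _; rewrite mul0r. Qed.

Section dotp.
Context (R : realType) (n : nat).
Implicit Types (v w x y : 'rV[R]_n).

Definition dotp v x : R := \sum_(i < n) v ord0 i * x ord0 i.

Lemma dotpDl v w x : dotp (v + w) x = dotp v x + dotp w x.
Proof. by rewrite -big_split; apply: eq_bigr => i _; rewrite !mxE mulrDl. Qed.

Lemma dotpZl a v x : dotp (a *: v) x = a * dotp v x.
Proof. by rewrite mulr_sumr; apply: eq_bigr => i _; rewrite !mxE mulrA. Qed.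

Lemma dotpC v x : dotp v x = dotp x v.
Proof. by apply: eq_bigr => i _; rewrite mulrC. Qed.

Lemma dotpDr v x y : dotp v (x + y) = dotp v x + dotp v y.
Proof. by rewrite dotpC dotpDl !(dotpC v). Qed.

Lemma dotpZr a v x : dotp v (a *: x) = a * dotp v x.
Proof. by rewrite dotpC dotpZl (dotpC v). Qed.

Lemma dotp_delta (i : 'I_n) x : dotp (delta_mx 0 i) x = x ord0 i.
Proof.
rewrite /dotp (bigD1 i)//= mxE !eqxx mul1r big1 ?addr0// => j ji.
by rewrite mxE (negbTE ji) andbF mul0r.
Qed.

Lemma dotp0 x : dotp 0 x = 0.
Proof. by apply: big1 => i _; rewrite mxE mul0r. Qed.

Lemma measurable_dotp v : measurable_fun setT (dotp v).
Proof.
apply: measurable_sum => i; apply: measurable_funM => //.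
exact: measurable_coor.
Qed.

Lemma dotp_le v x M : (forall i, `|x ord0 i| <= M) ->
  dotp v x <= \sum_(i < n) `|v ord0 i| * M.
Proof.
move=> xM; apply: ler_sum => i _; rewrite (le_trans (ler_norm _))// normrM.
by rewrite ler_wpM2l.
Qed.

End dotp.

Section laplace_injectivity.
Context (R : realType) (n : nat) (mu : {measure set 'rV[R]_n -> \bar R}).
Implicit Types k : 'rV[R]_n -> R.

(** Pointwise, so that every exponential weight is bounded wherever [k] is nonzero. *)
Definition bounded_support k :=
  exists M, forall x, k x != 0 -> forall i, `|x ord0 i| <= M.

Lemma bounded_support_dotp_le k v : bounded_support k ->
  exists M, forall x, k x != 0 -> dotp v x <= M.
Proof.
move=> [M kM]; exists (\sum_(i < n) `|v ord0 i| * M) => x /kM.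
exact: dotp_le.
Qed.

Lemma integrable_expR_dotp k v : bounded_support k ->
  mu.-integrable setT (EFin \o k) ->
  mu.-integrable setT (EFin \o (fun x => k x * expR (dotp v x))).
Proof.
move=> /(bounded_support_dotp_le v)[M kM] ik.
have := integrable_mul_expR ik (@measurable_dotp R n v) kM ler01.
by under eq_fun do rewrite /= mul1r.
Qed.

Lemma bounded_support_patch k A : bounded_support k -> bounded_support (k \_ A).
Proof.
move=> [M kM]; exists M => x; rewrite patchE; case: ifPn => // _; first exact: kM.
by rewrite eqxx.
Qed.

Definition laplace_null k := [/\ bounded_support k,
  mu.-integrable setT (EFin \o k) &
  forall v, \int[mu]_x (k x * expR (dotp v x)) = 0].

Lemma laplace_nullB k l :
  laplace_null k -> laplace_null l -> laplace_null (fun x => k x - l x).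
Proof.
move=> [[M kM] ik k0] [[N lN] il l0]; split.
- exists (Num.max M N) => x; have [kx|/kM kx _ i] := eqVneq (k x) 0.
    by rewrite kx sub0r oppr_eq0 => /lN lx i; rewrite le_max lx orbT.
  by rewrite le_max kx.
- exact: (integrableB measurableT ik il).
- move=> v; under eq_Rintegral do rewrite mulrBl.
  by rewrite RintegralB ?k0 ?l0 ?subrr//; apply: integrable_expR_dotp => //;
    [exists M|exists N].
Qed.

Lemma laplace_null_halfspace k (i : 'I_n) (t : R) : laplace_null k ->
  laplace_null (k \_ [set x : 'rV[R]_n | t < x ord0 i]).
Proof.
move=> [bk ik k0].
have mA : measurable [set x : 'rV[R]_n | t < x ord0 i].
  exact: (measurable_lt_fun t (measurable_coor i)).
split; [exact: bounded_support_patch|exact: integrable_patch|] => v.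
rewrite patchME -Rintegral_mkcond.
have [M kM] := bk.
(* All the moments vanish, being values of the transform of [k] at [v + N e_i]; hence [C = 0] and
   any [b < t] will do. *)
apply: (@laplace_tail _ _ _ mu _ (fun x : 'rV[R]_n => x ord0 i) M 0 (t - 1)).
- exact: integrable_expR_dotp.
- exact: measurable_coor.
- move=> x; rewrite mulf_eq0 negb_or => /andP[/kM/(_ i) + _].
  exact/le_trans/ler_norm.
- by rewrite ltrBlDr ltrDl.
- move=> N; rewrite mul0r normr_le0; apply/eqP.
  rewrite -(k0 (v + N%:R *: delta_mx 0 i)); apply: eq_Rintegral => x _.
  by rewrite dotpDl dotpZl dotp_delta expRD mulrA.
Qed.

(** The quantification over all [k] makes stability under intersection immediate: truncating to an
    intersection is truncating twice. *)
Let splitting := [set A : set 'rV[R]_n | measurable A /\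
  forall k, laplace_null k -> laplace_null (k \_ A)].

Let splittingC A : splitting A -> splitting (~` A).
Proof.
move=> [mA hA]; split; first exact: measurableC.
move=> k k0; rewrite (_ : _ \_ _ = (fun x => k x - (k \_ A) x)).
  exact: laplace_nullB (hA _ k0).
apply/funext => x; rewrite !patchE in_setC.
by case: (x \in A) => /=; rewrite ?subrr ?subr0.
Qed.

(** Finite intersections are successive truncations; dominated convergence passes to the countable
    one. *)
Let splitting_bigcap (F : (set 'rV[R]_n)^nat) :
  (forall i, splitting (F i)) -> splitting (\bigcap_i F i).
Proof.
move=> sF; have mF : measurable (\bigcap_i F i).
  by apply: bigcapT_measurable => i; exact: (sF i).1.
split => // k k0; pose h N := k \_ (\bigcap_(i < N) F i).
have h0 N : laplace_null (h N).
  rewrite /h; elim: N => [|N IH].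
    by rewrite bigcap_mkord big_ord0 patch_setT.
  have := (sF N).2 _ IH; congr laplace_null; apply/funext => x.
  rewrite !bigcap_mkord big_ord_recr/= !patchE in_setI andbC.
  by case: (x \in F N).
have [bk ik _] := k0.
split; [exact: bounded_support_patch|exact: integrable_patch|] => v.
rewrite patchME.
have iv := integrable_expR_dotp v bk ik.
have mkv : measurable_fun setT (fun x => k x * expR (dotp v x)).
  by apply/measurable_EFinP; exact: measurable_int iv.
have := @dominated_cvg_Rintegral _ _ _ mu (fun N x => h N x * expR (dotp v x))
  _ ((fun x => k x * expR (dotp v x)) \_ (\bigcap_i F i)) iv.
have -> : (fun N => \int[mu]_x (h N x * expR (dotp v x))) = cst 0.
  by apply/funext => N; have [_ _ ->] := h0 N.
have c0 : (cst 0 : nat -> R) @ \oo --> (0 : R) by exact: cvg_cst.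
move=> H; apply/esym/(cvg_unique (@norm_hausdorff _ _) c0).
apply: H => [N||N x|x].
- have [bh ih _] := h0 N; apply/measurable_EFinP.
  by have /measurable_int := integrable_expR_dotp v bh ih.
- by apply/measurable_restrict => //; rewrite setTI; exact: measurable_funS mkv.
- rewrite !normrM ler_wpM2r// /h patchE; case: ifPn => // _.
  by rewrite normr0.
- rewrite patchE; case: ifPn => [/set_mem Fx|/negP Fx].
    apply: cvg_near_cst; apply: nearW => N.
    by rewrite /h patchE mem_set// => i _; exact: Fx.
  have [i Fix] : exists i, ~ F i x.
    apply/not_existsP => h1; apply: Fx; rewrite inE => i _.
    by apply: contrapT => /h1.
  apply: cvg_near_cst; near=> N.
  rewrite /h patchE ifF ?mul0r//; apply/negP; rewrite inE => /(_ i) FNx; apply/Fix/FNx => /=.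
  by near: N; exact: nbhs_infty_gt.
Unshelve. all: by end_near. Qed.

(** [splitting] is a sigma-algebra containing the coordinate half-spaces. Generation is used twice:
    by open rays on the line, then by preimages under the coordinates. *)
Lemma laplace_null_patch k A : laplace_null k -> measurable A ->
  laplace_null (k \_ A).
Proof.
move=> k0 mA; suff: splitting A by move=> [_ /(_ k k0)].
have sS : sigma_algebra setT splitting.
  split.
  - rewrite -setCT; apply: splittingC; split => // k' k'0.
    by rewrite patch_setT.
  - by move=> B; rewrite setTD; exact: splittingC.
  - move=> F sF; rewrite -[X in splitting X]setCK setC_bigcup.
    by apply: splittingC; apply: splitting_bigcap => i; exact: splittingC.
move: A mA; apply: smallest_sub => //.
move=> A; rewrite -bigcup_seq => -[i _ [B mB <-]]; rewrite setTI.
have {mB} : (@RGenOInfty.G R).-sigma.-measurable B.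
  by rewrite -RGenOInfty.measurableE.
pose coor := fun x : 'rV[R]_n => x ord0 i.
suff : <<s @RGenOInfty.G R >> `<=` [set B | splitting (coor @^-1` B)] by exact.
have [s0 sC sU] := sS.
apply: smallest_sub; first split => /=.
- by rewrite preimage_set0.
- move=> C; rewrite setTD preimage_setC; exact: splittingC.
- by move=> F sF; rewrite preimage_bigcup; exact: sU.
move=> _ [t ->]; rewrite /= (_ : _ @^-1` _ = [set x : 'rV[R]_n | t < x ord0 i]); last first.
  by apply/seteqP; split => x /=; rewrite in_itv/= andbT.
split; last by move=> k' k'0; exact: laplace_null_halfspace.
exact: (measurable_lt_fun t (measurable_coor i)).
Qed.

Lemma laplace_null_ae0 k : laplace_null k -> {ae mu, forall x, k x = 0}.
Proof.
move=> k0; have [_ ik _] := k0.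
have mk : measurable_fun setT k.
  by apply/measurable_EFinP; exact: measurable_int ik.
have mA : measurable [set x | 0 < k x] by exact: measurable_lt_fun.
have kA := laplace_null_patch k0 mA.
(* With [k+] the truncation to [0 < k x], the function [k+ - (k - k+)] is [|k|]; its transform at 0
   is the integral of [|k|]. *)
have [_ ia /(_ 0)] := laplace_nullB kA (laplace_nullB k0 kA).
under eq_Rintegral do rewrite dotp0 expR0 mulr1.
rewrite (_ : (fun x => _) = (fun x => `|k x|)); last first.
  apply/funext => x; rewrite patchE; case: ifPn => [/set_mem/= k_gt0|/negP k_le0].
    by rewrite subrr subr0 gtr0_norm.
  rewrite subr0 sub0r ler0_norm// leNgt; apply/negP => k_gt0; apply: k_le0.
  by rewrite inE.
have {}ia : mu.-integrable setT (EFin \o (fun x => `|k x|)).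
  exact: integrable_norm.
move=> h1; have := congr1 EFin h1; rewrite fineK; last exact: integrable_fin_num.
have mEk : measurable_fun setT (EFin \o k) by exact/measurable_EFinP.
move=> h0; have [N [mN N0 hN]] := (ae_eq_integral_abs mu measurableT mEk).1 h0.
exists N; split => // x /= kx; apply: hN => /= /(_ I) [].
exact: kx.
Qed.

End laplace_injectivity.

(** * Translations and boxes *)

Section lebesgue_translation.
Context (R : realType).

Let shift (a : R) : measurableTypeR R -> measurableTypeR R := fun t => t + a.

Let measurable_shift a : measurable_fun setT (shift a).
Proof. by apply: measurable_funD. Qed.

HB.instance Definition _ a := isMeasurableFun.Build _ _ _ _ (shift a)
  (measurable_shift a).

Lemma ge0_integral_shift (a : R) (f : R -> \bar R) :
  measurable_fun setT f -> (forall t, 0 <= f t)%E ->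
  (\int[lebesgue_measure]_t f (t + a)%R = \int[lebesgue_measure]_t f t)%E.
Proof.
move=> mf f0.
have := @ge0_integral_pushforward _ _ _ _ R (shift a) (measurable_shift a)
  lebesgue_measure setT f measurableT mf.
rewrite preimage_setT => <-; last by move=> y _; exact: f0.
apply: eq_measure_integral => A mA _.
rewrite -[LHS]/(mpushforward lebesgue_measure (shift a) A).
apply/esym/lebesgue_measure_unique => // _ [[b c]] _ <-.
rewrite -[RHS]/(lebesgue_measure (shift a @^-1` `]b, c]%classic)).
rewrite (_ : _ @^-1` _ = `]b - a, c - a]%classic); last first.
  by apply/seteqP; split => x /=; rewrite !in_itv/= ltrBlDr lerBrDr.
rewrite !lebesgue_measure_itv/= !lte_fin ltrD2r -!EFinD.
by case: ifP => // _; congr EFin; ring.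
Qed.

End lebesgue_translation.

Section lebesgue_rV.
Context (R : realType).

Lemma rV_unconsK n : cancel (@rV_uncons R n) (@rV_cons R n).
Proof.
move=> x; rewrite /rV_cons /rV_uncons /=.
apply: etrans (@hsubmxK _ 1 1 n x); congr (row_mx _ _).
apply/rowP => i; rewrite !mxE !ord1 eqxx mulr1n; congr (x _ _).
exact: val_inj.
Qed.

Lemma rV_consD n p q : @rV_cons R n p + rV_cons q = rV_cons (p.1 + q.1, p.2 + q.2).
Proof.
apply/rowP => i; rewrite mxE.
have [j ->|j ->] := split_ordP (i : 'I_(1 + n)).
  by rewrite !(row_mxEl (_ : 'rV_1) (_ : 'rV_n)) !mxE -mulrnDl.
by rewrite !(row_mxEr (_ : 'rV_1) (_ : 'rV_n)) mxE.
Qed.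

Lemma lebesgue_rVS n (A : set 'rV[R]_n.+1) : lebesgue_rV A =
  (\int[lebesgue_measure]_t lebesgue_rV (xsection (@rV_cons R n @^-1` A) t))%E.
Proof. by []. Qed.

Lemma measurable_addr n (a : 'rV[R]_n) : measurable_fun setT (fun x : 'rV[R]_n => x + a).
Proof.
apply: measurable_fun_coor => i; under eq_fun do rewrite mxE.
by apply: measurable_funD => //; exact: measurable_coor.
Qed.

(** Induction on the dimension: the slices move by the induction hypothesis, their parameter by
    [ge0_integral_shift]. *)
Lemma lebesgue_rV_translation n (a : 'rV[R]_n) (A : set 'rV[R]_n) : measurable A ->
  lebesgue_rV ((fun x : 'rV[R]_n => x + a) @^-1` A) = lebesgue_rV A.
Proof.
elim: n a A => [|n IH] a A mA.
  congr (lebesgue_rV _); apply/seteqP.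
  by split => x /=; rewrite (thinmx0 (x + a)) (thinmx0 x).
have mB : measurable (@rV_cons R n @^-1` A).
  by rewrite -[X in measurable X]setTI; exact: measurable_rV_cons.
rewrite !lebesgue_rVS.
rewrite -[RHS](ge0_integral_shift (rV_uncons a).1); last 2 first.
- exact: measurable_fun_xsection.
- by move=> t; exact: measure_ge0.
apply: eq_integral => t _; rewrite -[RHS](IH (rV_uncons a).2); last exact: measurable_xsection.
congr (lebesgue_rV _); apply/seteqP.
have aE x : rV_cons (t, x) + a =
    rV_cons (t + (rV_uncons a).1, x + (rV_uncons a).2).
  by rewrite -[in LHS](rV_unconsK a) rV_consD.
by split => x /=; rewrite /xsection/= !inE/= aE.
Qed.

Lemma forall_rVS n (x a : 'rV[R]_n.+1) (Q : R -> R -> Prop) :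
  (forall i, Q (x ord0 i) (a ord0 i)) <-> Q (rV_uncons x).1 (rV_uncons a).1 /\
  forall i, Q ((rV_uncons x).2 ord0 i) ((rV_uncons a).2 ord0 i).
Proof.
split=> [Qxa|[Q0 Qxa] i]; first by split => [|i]; rewrite /= ?mxE; exact: Qxa.
have [j ->|j ->] := split_ordP (i : 'I_(1 + n)).
  by rewrite (_ : lshift n j = ord0)//; apply: val_inj; rewrite /= ord1.
by have := Qxa j; rewrite /= !mxE.
Qed.

Lemma measurable_box n (a : 'rV[R]_n) (e : R) :
  measurable [set x : 'rV[R]_n | forall i, `|x ord0 i - a ord0 i| < e].
Proof.
rewrite (_ : [set x | _] =
    \bigcap_(i : 'I_n) ((fun x : 'rV[R]_n => x ord0 i) @^-1` ball (a ord0 i) e)).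
  apply: fin_bigcap_measurable => // i _; rewrite -[X in measurable X]setTI.
  by apply: measurable_coor => //; exact: measurable_ball.
by apply/seteqP; split => x /= xa i; [move=> _|]; have := xa i;
  rewrite /ball/= distrC //; apply.
Qed.

(** Cubes serve twice: they bound the measure of bounded sets from above, and they provide a set of
    positive measure around a prescribed direction. *)
Lemma lebesgue_rV_box n (a : 'rV[R]_n) (e : R) : 0 <= e ->
  lebesgue_rV [set x : 'rV[R]_n | forall i, `|x ord0 i - a ord0 i| < e] =
  ((e *+ 2) ^+ n)%:E.
Proof.
move=> e0; elim: n a => [|n IH] a.
  by rewrite /= diracE mem_set// => -[].
rewrite (_ : lebesgue_rV _ = (lebesgue_measure \x lebesgue_rV)%E
    (ball (a ord0 ord0 : R) e `*`
     [set x : 'rV[R]_n | forall i, `|x ord0 i - (rV_uncons a).2 ord0 i| < e])).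
  rewrite product_measure1E ?lebesgue_measure_ball ?IH ?exprS//.
  - by rewrite EFinM; congr (_ * _)%E; exact: lebesgue_measure_ball.
  - exact: (@measurable_ball R).
  - exact: measurable_box.
rewrite -[LHS]/((lebesgue_measure \x lebesgue_rV)%E (@rV_cons R n @^-1` _)).
congr ((_ \x _)%E _); apply/seteqP; split => -[t x] /=.
  move=> /(forall_rVS _ _ (fun b c => `|b - c| < e)).
  rewrite rV_consK => -[ta xa]; split => //.
  by rewrite /ball/= distrC.
move=> [ta xa]; apply/(forall_rVS _ _ (fun b c => `|b - c| < e)).
by rewrite rV_consK; split => //; rewrite distrC.
Qed.

End lebesgue_rV.

(** * Euclidean geometry *)

Section enorm.
Context (R : realType) (n : nat).
Implicit Types (v x y : 'rV[R]_n).

Lemma enorm_ge0 x : 0 <= enorm x.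
Proof. exact: sqrtr_ge0. Qed.

Lemma dotpxx x : dotp x x = enorm x ^+ 2.
Proof. by rewrite sqr_sqrtr// sumr_ge0// => i _; exact: sqr_ge0. Qed.

Lemma coor_le_enorm x i : `|x ord0 i| <= enorm x.
Proof.
rewrite -(@ler_pXn2r _ 2)// ?nnegrE ?enorm_ge0// real_normK ?num_real//.
rewrite -dotpxx /dotp (bigD1 i)//= -expr2 lerDl sumr_ge0// => j _.
by rewrite -expr2 sqr_ge0.
Qed.

Lemma enorm_le_coor x e : 0 <= e -> (forall i, `|x ord0 i| <= e) ->
  enorm x <= n%:R * e.
Proof.
move=> e0 xe; rewrite -(@ler_pXn2r _ 2)// ?nnegrE ?enorm_ge0 ?mulr_ge0//.
rewrite -dotpxx; apply: (@le_trans _ _ (\sum_(i < n) e ^+ 2)).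
  apply: ler_sum => i _; rewrite -expr2 -real_normK ?num_real//.
  by rewrite lerXn2r ?nnegrE.
rewrite sumr_const card_ord exprMn -[leLHS]mulr_natl ler_wpM2r ?sqr_ge0//.
by rewrite -natrX ler_nat; case: n => // m; rewrite expnS leq_pmulr.
Qed.

Lemma enorm0_eq0 x : enorm x = 0 -> x = 0.
Proof.
move=> x0; apply/rowP => i; apply/eqP.
by rewrite mxE -normr_le0 -x0 coor_le_enorm.
Qed.

Lemma dotp_le_enorm v x : dotp v x <= enorm v * enorm x.
Proof.
have [/enorm0_eq0 ->|v0] := eqVneq (enorm v) 0.
  by rewrite dotp0 mulr_ge0 ?enorm_ge0.
have [/enorm0_eq0 ->|x0] := eqVneq (enorm x) 0.
  by rewrite dotpC dotp0 mulr_ge0 ?enorm_ge0.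
have a0 : 0 < enorm v * enorm x.
  by rewrite mulr_gt0// lt_neqAle eq_sym ?v0 ?x0 enorm_ge0.
(* Expanded, this is [2 * enorm v * enorm x * (enorm v * enorm x - dotp v x)]. *)
have : 0 <= dotp (enorm x *: v + - enorm v *: x) (enorm x *: v + - enorm v *: x).
  by rewrite dotpxx sqr_ge0.
rewrite !dotpDl !dotpDr !dotpZl !dotpZr !dotpxx (dotpC x v) => h.
by rewrite -(ler_pM2l a0); nra.
Qed.

Lemma dotp_ge_enorm v x : - (enorm v * enorm x) <= dotp v x.
Proof.
rewrite lerNl -mulN1r -dotpZr (le_trans (dotp_le_enorm _ _))//.
by rewrite le_eqVlt /enorm; apply/orP; left; apply/eqP; congr (_ * Num.sqrt _);
  apply: eq_bigr => i _; rewrite mxE mulN1r sqrrN.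
Qed.

Lemma enormZ a x : 0 <= a -> enorm (a *: x) = a * enorm x.
Proof.
move=> a0; apply/eqP; rewrite -(@eqrXn2 _ 2) ?mulr_ge0 ?enorm_ge0//.
by rewrite exprMn -!dotpxx dotpZl dotpZr mulrA expr2.
Qed.

Lemma enorm_triangle x y : enorm (x + y) <= enorm x + enorm y.
Proof.
rewrite -(@ler_pXn2r _ 2)// ?nnegrE ?addr_ge0 ?enorm_ge0//.
rewrite -dotpxx dotpDl !dotpDr !dotpxx (dotpC y x).
have := dotp_le_enorm x y; nra.
Qed.

Lemma enormN x : enorm (- x) = enorm x.
Proof.
by congr (Num.sqrt _); apply: eq_bigr => i _; rewrite mxE sqrrN.
Qed.

Lemma enorm_normalize x : 0 < enorm x -> enorm (normalize x) = 1.
Proof.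
move=> x0; rewrite enormZ ?invr_ge0 ?enorm_ge0// mulVf//.
by rewrite gt_eqF.
Qed.

Lemma lebesgue_rV_bounded (A : set 'rV[R]_n) e : measurable A -> 0 <= e ->
  (forall x, A x -> enorm x < e) -> (lebesgue_rV A < +oo)%E.
Proof.
move=> mA e0 Ae; apply: (@le_lt_trans _ _ ((e *+ 2) ^+ n)%:E); last exact: ltry.
rewrite -(@lebesgue_rV_box _ _ 0)//; apply: le_measure; rewrite ?inE//.
  exact: measurable_box.
by move=> x /Ae xe i; rewrite mxE subr0 (le_lt_trans _ xe)// coor_le_enorm.
Qed.

(* Around [- v / (2 |v|)] the direction [normalize z] is almost opposite to
   [v]. *)
Lemma cap_box v e : 0 < enorm v -> 0 < e ->
  exists (a : 'rV[R]_n) (dl : R), [/\ 0 < dl &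
    forall z : 'rV[R]_n, (forall i, `|z ord0 i - a ord0 i| < dl) ->
      punctured_ball z /\ dotp v (normalize z) <= e - enorm v].
Proof.
(* [eta] will bound [enorm (z - a)], where [enorm a] is 1/2: at most 1/4, it keeps [enorm z] between
   1/4 and 3/4; the other bound makes the error [enorm v * eta] small against [e]. *)
move=> v0 e0; pose eta := Num.min (4^-1) (e / (4 * enorm v)).
have eta0 : 0 < eta by rewrite /eta lt_min invr_gt0 divr_gt0 ?mulr_gt0 ?ltr0n.
have eta4 : eta <= 4^-1 by rewrite /eta ge_min lexx.
have etae : eta * (4 * enorm v) <= e.
  by rewrite -ler_pdivlMr ?mulr_gt0// /eta ge_min lexx orbT.
pose a : 'rV[R]_n := - ((2 * enorm v)^-1 *: v).
exists a; exists (eta / n.+1%:R); split; first by rewrite divr_gt0.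
move=> z hz; pose h := z - a.
have zE : z = a + h by rewrite /h addrC subrK.
have heta : enorm h <= eta.
  have /le_trans -> // : enorm h <= n%:R * (eta / n.+1%:R).
    apply: enorm_le_coor => [|i]; first by rewrite divr_ge0// ltW.
    rewrite (_ : h ord0 i = z ord0 i - a ord0 i) ?ltW ?hz//.
    by rewrite mxE; congr (_ + _); rewrite mxE.
  by rewrite mulrCA ler_piMr ?(ltW eta0)// ler_pdivrMr// mul1r ler_nat.
have na : enorm a = 2^-1.
  rewrite enormN enormZ ?invr_ge0 ?mulr_ge0 ?enorm_ge0// invfM -mulrA mulVf ?mulr1//.
  by rewrite gt_eqF.
have zle : enorm z <= 2^-1 + eta.
  by rewrite zE (le_trans (enorm_triangle _ _))// na lerD2l.
have zge : 2^-1 - eta <= enorm z.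
  rewrite lerBlDr -na (_ : a = z + - h); last by rewrite /h opprB addrC subrK.
  by rewrite (le_trans (enorm_triangle _ _))// enormN lerD2l.
have z0 : 0 < enorm z by lra.
split; first by rewrite /punctured_ball/= z0/=; lra.
rewrite dotpZr mulrC ler_pdivrMr//.
have dva : dotp v a = - (enorm v / 2).
  rewrite /a -scaleNr dotpZr dotpxx expr2 invfM.
  have : enorm v != 0 by rewrite gt_eqF.
  by move=> vn0; field.
have dvh : dotp v h <= enorm v * eta.
  by rewrite (le_trans (dotp_le_enorm _ _))// ler_wpM2l// ltW.
rewrite zE dotpDr -zE dva.
have := mulr_gt0 v0 eta0.
move=> ve0.
have : 0 <= (e - eta * (4 * enorm v)) * enorm z.
  by rewrite mulr_ge0 ?subr_ge0 ?enorm_ge0.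
have : 0 <= enorm v * (1 - 4 * eta) * (2^-1 + eta - enorm z).
  by apply: mulr_ge0; [apply: mulr_ge0; [exact: ltW|lra]|lra].
have : 0 <= enorm v * eta * eta by rewrite !mulr_ge0// ltW.
nra.
Qed.

End enorm.

(** * Spherical means *)

Section translation.
Context (R : realType) (n : nat).
Local Notation leb := (@lebesgue_rV R n).
Local Open Scope ereal_scope.

Let pushforward_addr (a : 'rV[R]_n) A : measurable A ->
  pushforward leb (fun x : 'rV[R]_n => x + a)%R A = leb A.
Proof. exact: lebesgue_rV_translation. Qed.

Lemma ge0_integral_translation (a : 'rV[R]_n) (f : 'rV[R]_n -> \bar R) :
  measurable_fun setT f -> (forall x, 0 <= f x) ->
  \int[leb]_x f (x + a)%R = \int[leb]_x f x.
Proof.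
move=> mf f0.
rewrite -[LHS](@ge0_integral_pushforward _ _ _ _ R _ (measurable_addr a) leb setT)//.
apply: eq_measure_integral; first exact: measurable_addr.
by move=> ? A mA _; exact: pushforward_addr.
Qed.

Lemma integrable_translation (a : 'rV[R]_n) (f : 'rV[R]_n -> R) :
  leb.-integrable setT (EFin \o f) ->
  leb.-integrable setT (EFin \o (fun x => f (x + a)%R)).
Proof.
move=> /integrableP[mf foo]; apply/integrableP; split.
  exact: (measurableT_comp mf (measurable_addr a)).
rewrite (@ge0_integral_translation a (abse \o (EFin \o f)))//; last 2 first.
- exact: measurableT_comp.
- by move=> x; exact: abse_ge0.
Qed.

Lemma Rintegral_translation (a : 'rV[R]_n) (f : 'rV[R]_n -> R) :
  leb.-integrable setT (EFin \o f) ->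
  (\int[leb]_x f (x + a) = \int[leb]_x f x)%R.
Proof.
move=> intf; congr fine.
rewrite -[LHS](@integral_pushforward _ _ _ _ R _ (measurable_addr a) leb setT
  (EFin \o f))//.
- apply: eq_measure_integral; first exact: measurable_addr.
  by move=> ? A mA _; exact: pushforward_addr.
- exact: measurable_int intf.
- exact: integrable_translation.
Qed.

End translation.

Section sphere_mean.
Context (R : realType) (n : nat) (r : R).
Hypothesis r0 : 0 < r.
Local Notation leb := (@lebesgue_rV R n).
Local Notation B := (@punctured_ball R n).
Local Notation pt := (fun y z : 'rV[R]_n => dilate r y (normalize z)).

Lemma punctured_ball_lty : (leb B < +oo)%E.
Proof.
apply: (@lebesgue_rV_bounded _ _ _ 1); [exact: measurable_punctured_ball|by []|].
by move=> x /andP[].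
Qed.

Lemma measurable_sphere (y : 'rV[R]_n) : measurable (sphere r y).
Proof.
rewrite (_ : sphere r y =
    setT `&` (@enorm R n \o (fun x => x + - y)) @^-1` [set r]); last first.
  by rewrite setTI.
apply: measurableT_comp => //; first exact: measurable_enorm.
exact: measurable_addr.
Qed.

Lemma sphere_dilate_normalize y z : B z -> sphere r y (pt y z).
Proof.
move=> /andP[z0 _]; rewrite /sphere/= /dilate addrC addKr.
by rewrite enormZ ?enorm_normalize ?mulr1// ltW.
Qed.

Lemma measurable_dilate_normalize y : measurable_fun setT (pt y).
Proof.
by apply: measurableT_comp; [exact: measurable_dilate|exact: measurable_normalize].
Qed.

(** Unfolding the two pushforwards gives an integral over a domain that does not depend on [y],
    which is the form that Fubini needs. *)
Lemma ge0_integral_sphere_measure y (f : 'rV[R]_n -> \bar R) :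
  measurable_fun setT f -> (forall x, 0 <= f x)%E ->
  (\int[sphere_measure r y]_(x in sphere r y) f x =
   (`|r| ^+ n.-1 * n%:R)%:E * \int[leb]_(z in B) f (pt y z))%E.
Proof.
move=> mf f0.
have mS : measurable (dilate r y @^-1` sphere r y).
  rewrite -[X in measurable X]setTI; apply: measurable_dilate => //.
  exact: measurable_sphere.
have mfd : measurable_fun setT (f \o dilate r y).
  by apply: measurableT_comp => //; exact: measurable_dilate.
rewrite /sphere_measure ge0_integral_mscale//; last 2 first.
- exact: measurable_sphere.
- exact: measurable_funS mf.
rewrite EFinM -muleA; congr (_ * _)%E.
rewrite [LHS](@ge0_integral_pushforward _ _ _ _ R _ (@measurable_dilate R n r y)
  (unit_sphere_measure R n) (sphere r y) f (measurable_sphere y))//; last first.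
  exact: measurable_funS mf.
rewrite /unit_sphere_measure ge0_integral_mscale//; last 2 first.
- exact: measurable_funS mfd.
- by move=> x _; exact: f0.
congr (_ * _)%E.
rewrite [LHS](@ge0_integral_pushforward _ _ _ _ R _ (@measurable_normalize R n)
  _ _ (f \o dilate r y) mS)//; last 2 first.
- exact: measurable_funS mfd.
- by move=> x _; exact: f0.
(* [D] may be larger than the punctured ball, but the measure pushed by [normalize] is restricted to
   that ball, so the excess is negligible. *)
set D := _ @^-1` _; have BD : B `<=` D.
  by move=> z /(sphere_dilate_normalize y).
have mD : measurable D.
  by rewrite -[X in measurable X]setTI; exact: measurable_normalize.
have mfn : measurable_fun setT ((f \o dilate r y) \o @normalize R n).
  by apply: measurableT_comp => //; exact: measurable_normalize.
rewrite (@ge0_negligible_integral _ _ _ _ D (~` B))//.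
- rewrite setDE setCK setIidr//; apply: eq_measure_integral => A mA AB.
  by rewrite /= /mrestr setIidl.
- by apply: measurableC; exact: measurable_punctured_ball.
- exact: measurable_funS mfn.
- by move=> x _; exact: f0.
- by rewrite /= /mrestr setICl measure0.
Qed.

Lemma integral_sphere_measure y (f : 'rV[R]_n -> R) : measurable_fun setT f ->
  leb.-integrable B (EFin \o (f \o pt y)) ->
  (spherical_transform r f y =
   (`|r| ^+ n.-1 * n%:R)%:E * \int[leb]_(z in B) (f (pt y z))%:E)%E.
Proof.
move=> mf intf; have mEf : measurable_fun setT (EFin \o f) by exact/measurable_EFinP.
rewrite /spherical_transform integralE.
rewrite !ge0_integral_sphere_measure//; last 2 first.
- exact: measurable_funeneg.
- exact: measurable_funepos.
rewrite -muleBr//; last first.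
  apply: fin_num_adde_defl; rewrite fin_numN; apply: integrable_fin_num.
    exact: measurable_punctured_ball.
  rewrite -[X in _.-integrable _ X]/((EFin \o f)^\-%E \o pt y) -funeneg_comp.
  by apply: integrable_funeneg => //; exact: measurable_punctured_ball.
congr (_ * _)%E; rewrite [RHS]integralE; congr (_ - _)%E.
- by apply: eq_integral => z _; rewrite !funeposE.
- by apply: eq_integral => z _; rewrite !funenegE.
Qed.

End sphere_mean.

(** * Fubini's theorem for spherical means *)

Section sphere_mean_transform.
Context (R : realType) (n : nat) (r : R).
Hypothesis r0 : 0 < r.
Local Notation leb := (@lebesgue_rV R n).
Local Notation B := (@punctured_ball R n).
Local Notation pt := (fun y z : 'rV[R]_n => dilate r y (normalize z)).

Let mB : measurable B := @measurable_punctured_ball R n.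

Lemma measurable_dilate_normalize2 :
  measurable_fun setT (fun p : 'rV[R]_n * 'rV[R]_n => pt p.1 p.2).
Proof.
apply: measurable_fun_coor => i.
rewrite (_ : (fun _ => _) = (fun p : 'rV[R]_n * 'rV[R]_n =>
    p.1 ord0 i + r * (normalize p.2) ord0 i)); last first.
  by apply/funext => p; rewrite !mxE.
apply: measurable_funD.
  exact: (measurableT_comp (measurable_coor i) measurable_fst).
apply: measurable_funM => //.
apply: (measurableT_comp (measurable_coor i)).
exact: (measurableT_comp (@measurable_normalize R n) measurable_snd).
Qed.

Let indic_ge0 (z : 'rV[R]_n) : 0 <= \1_B z :> R.
Proof. by rewrite indicE. Qed.

Let measurable_indic_snd :
  measurable_fun setT (fun p : 'rV[R]_n * 'rV[R]_n => \1_B p.2 : R).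
Proof. by apply: (measurableT_comp _ measurable_snd). Qed.

(** For fixed [z] the map from [y] to [dilate r y (normalize z)] is a translation, so the inner
    integral over [y] does not depend on [z]. *)
Lemma ge0_integral_sphere_mean (f : 'rV[R]_n -> \bar R) :
  measurable_fun setT f -> (forall x, 0 <= f x)%E ->
  (\int[leb]_y \int[leb]_z (f (pt y z) * (\1_B z)%:E) =
   leb B * \int[leb]_x f x)%E.
Proof.
move=> mf f0.
have mF : measurable_fun setT (fun p : 'rV[R]_n * 'rV[R]_n =>
    f (pt p.1 p.2) * (\1_B p.2)%:E)%E.
  apply: emeasurable_funM.
    exact: (measurableT_comp mf measurable_dilate_normalize2).
  exact/measurable_EFinP.
rewrite (@fubini_tonelli _ _ _ _ _ leb leb _ mF); last first.
  by move=> p /=; rewrite mule_ge0.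
transitivity (\int[leb]_z (\int[leb]_x f x * (\1_B z)%:E))%E.
  apply: eq_integral => z _ /=; rewrite ge0_integralZr//.
  - congr (_ * _)%E.
    exact: (ge0_integral_translation (r *: normalize z)).
  - exact: (measurableT_comp mf (measurable_addr (r *: normalize z))).
rewrite ge0_integralZl//; last 2 first.
- exact/measurable_EFinP.
- exact: integral_ge0.
by rewrite integral_indic// setIT muleC.
Qed.

Lemma integrable_sphere_mean (k : 'rV[R]_n -> R) :
  leb.-integrable setT (EFin \o k) ->
  (leb \x leb)%E.-integrable setT (EFin \o (fun p => k (pt p.1 p.2) * \1_B p.2)).
Proof.
move=> ik; have mk := measurable_int _ ik.
have mf : measurable_fun setT (EFin \o (fun p => k (pt p.1 p.2) * \1_B p.2)).
  apply/measurable_EFinP; apply: measurable_funM => //.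
  apply: measurableT_comp measurable_dilate_normalize2.
  exact/measurable_EFinP.
apply/(@integrable12ltyP _ _ _ _ _ leb leb _ mf).
under eq_integral => y _.
  under eq_integral => z _ do rewrite /= normrM (ger0_norm (indic_ge0 _)) EFinM.
  over.
rewrite (@ge0_integral_sphere_mean (fun x => `|k x|%:E))//; last first.
  by apply/measurable_EFinP; apply: measurableT_comp => //; exact/measurable_EFinP.
rewrite lte_mul_pinfty//; first by rewrite ge0_fin_numE// punctured_ball_lty.
by have /integrableP[] := ik.
Qed.

Lemma integrable_indicE (y : 'rV[R]_n) (k : 'rV[R]_n -> R) :
  leb.-integrable B (EFin \o (k \o pt y)) <->
  leb.-integrable setT (fun z => (k (pt y z) * \1_B z)%:E).
Proof.
rewrite (_ : (fun z => _) = (EFin \o (k \o pt y)) \_ B).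
  exact: integrable_mkcond.
apply/funext => z; rewrite patchE indicE.
by case: (z \in B); rewrite /= ?mulr1 ?mulr0.
Qed.

Lemma integral_indicE (y : 'rV[R]_n) (k : 'rV[R]_n -> R) :
  (\int[leb]_z (k (pt y z) * \1_B z)%:E = \int[leb]_(z in B) (k (pt y z))%:E)%E.
Proof.
rewrite [RHS]integral_mkcond; apply: eq_integral => z _; rewrite patchE indicE.
by case: (z \in B); rewrite /= ?mulr1 ?mulr0.
Qed.

Lemma ae_integrable_sphere_mean (k : 'rV[R]_n -> R) :
  leb.-integrable setT (EFin \o k) ->
  {ae leb, forall y, leb.-integrable B (EFin \o (k \o pt y))}.
Proof.
move=> /integrable_sphere_mean/ae_integrable1; apply: filterS => y /= iy.
exact/integrable_indicE.
Qed.

(** Almost every sphere of radius [r] meets a null set in surface measure zero: integrated over all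
    centers, the means of [|k|] give [leb B * 0]. *)
Lemma ae0_sphere_mean (k : 'rV[R]_n -> R) : measurable_fun setT k ->
  {ae leb, forall x, k x = 0} ->
  {ae leb, forall y, (\int[leb]_(z in B) (k (pt y z))%:E = 0)%E}.
Proof.
move=> mk k0.
have mEk : measurable_fun setT (EFin \o k) by exact/measurable_EFinP.
have I0 : (\int[leb]_x `|(EFin \o k) x| = 0)%E.
  apply/ae_eq_integral_abs => //.
  by apply: filterS k0 => x kx _; rewrite /= kx.
have ik : leb.-integrable setT (EFin \o k) by apply/integrableP; split=> //; rewrite I0.
have mT : measurable_fun setT (fun p => (`|k (pt p.1 p.2)| * \1_B p.2)%:E).
  have /measurable_int/measurable_EFinP/= := integrable_sphere_mean (integrable_norm ik).
  by move=> ?; exact/measurable_EFinP.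
have f0 (p : 'rV[R]_n * 'rV[R]_n) :
    (0 <= (`|k (pt p.1 p.2)| * \1_B p.2)%:E)%E by rewrite lee_fin mulr_ge0.
have mF : measurable_fun setT
    (fun y => \int[leb]_z (`|k (pt y z)| * \1_B z)%:E)%E.
  exact: (measurable_fun_fubini_tonelli_F _ mT).
have : (\int[leb]_y `| \int[leb]_z (`|k (pt y z)| * \1_B z)%:E | = 0)%E.
  under eq_integral => y _.
    rewrite gee0_abs; last by apply: integral_ge0 => z _; rewrite lee_fin mulr_ge0.
    under eq_integral => z _ do rewrite EFinM.
    over.
  rewrite (@ge0_integral_sphere_mean (fun x => `|k x|%:E))//.
    by rewrite [X in (_ * X)%E]I0 mule0.
  by apply/measurable_EFinP; exact: measurableT_comp.
move=> /(ae_eq_integral_abs leb measurableT mF).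
apply: filterS => y /(_ I) /= hy.
rewrite -integral_indicE; apply/eqP; rewrite -abse_eq0 eq_le abse_ge0 andbT.
rewrite -hy; apply: le_trans (le_abse_integral _ _ _) _ => //.
  apply/measurable_EFinP; apply: measurable_funM => //.
  by apply: measurableT_comp => //; exact: measurable_dilate_normalize.
by under eq_integral => z _ do rewrite /= normrM (ger0_norm (indic_ge0 _)).
Qed.

End sphere_mean_transform.

(** * Growth of the Laplace transform and vanishing on half-spaces *)

Section sphere_mean_growth.
Context (R : realType) (n : nat) (r : R).
Hypothesis r0 : 0 < r.
Local Notation leb := (@lebesgue_rV R n).
Local Notation B := (@punctured_ball R n).
Local Notation pt := (fun y z : 'rV[R]_n => dilate r y (normalize z)).

Let indic_ge0 (z : 'rV[R]_n) : 0 <= \1_B z :> R.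
Proof. by rewrite indicE. Qed.

(** Up to a constant factor, its integral is the Laplace transform at [- v] of the surface measure
    of the sphere of radius [r] around 0. *)
Definition sphere_weight v (z : 'rV[R]_n) : R :=
  expR (- r * dotp v (normalize z)) * \1_B z.

Let weight_ge0 v z : 0 <= sphere_weight v z.
Proof. by rewrite mulr_ge0// expR_ge0. Qed.

Let weight_le v z : sphere_weight v z <= expR (r * enorm v) * \1_B z.
Proof.
rewrite /sphere_weight indicE; have [/set_mem/andP[z0 _]|] := boolP (z \in _); last first.
  by rewrite !mulr0.
rewrite !mulr1 ler_expR mulNr -mulrN ler_wpM2l ?(ltW r0)// lerNl.
by have := dotp_ge_enorm v (normalize z); rewrite enorm_normalize// mulr1.
Qed.

Let measurable_weight v : measurable_fun setT (sphere_weight v).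
Proof.
apply: measurable_funM; last first.
  by apply: measurable_indic; exact: measurable_punctured_ball.
apply: measurableT_comp => //; apply: measurable_funM => //.
by apply: measurableT_comp; [exact: measurable_dotp|exact: measurable_normalize].
Qed.

Let integrable_indicB : leb.-integrable setT (EFin \o \1_B).
Proof.
have mB := @measurable_punctured_ball R n.
apply/integrableP; split; first exact/measurable_EFinP/measurable_indic.
under eq_integral do rewrite /= ger0_norm//.
by rewrite integral_indic// setIT; exact: punctured_ball_lty.
Qed.

Let integrable_weight v : leb.-integrable setT (EFin \o sphere_weight v).
Proof.
apply: le_integrable (integrable_scale (expR (r * enorm v)) integrable_indicB) => //.
  exact/measurable_EFinP.
by move=> z _; rewrite lee_fin !ger0_norm ?weight_le// mulr_ge0// expR_ge0.
Qed.

Let kernelE (k : 'rV[R]_n -> R) v y z :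
  k (pt y z) * expR (dotp v y) * \1_B z =
  k (pt y z) * expR (dotp v (pt y z)) * sphere_weight v z.
Proof.
rewrite /sphere_weight mulrA -(mulrA (k _) (expR _) (expR _)) -expRD.
congr (k _ * expR _ * _).
by rewrite /dilate dotpDr dotpZr mulNr addrK.
Qed.

Let integrable_kernel (k : 'rV[R]_n -> R) v :
  leb.-integrable setT (EFin \o k) -> bounded_support k ->
  (leb \x leb)%E.-integrable setT
    (fun p => (k (pt p.1 p.2) * expR (dotp v p.1) * \1_B p.2)%:E).
Proof.
move=> ik bk; have ie := integrable_expR_dotp v bk ik.
have iT := integrable_sphere_mean r ie.
apply: le_integrable (integrable_scale (expR (r * enorm v)) iT) => //.
  apply/measurable_EFinP; under eq_fun do rewrite kernelE.
  apply: measurable_funM.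
    have /measurable_int/measurable_EFinP mke := ie.
    have mkp := measurableT_comp mke (@measurable_dilate_normalize2 R n r).
    exact: mkp.
  exact: (measurableT_comp (measurable_weight v) measurable_snd).
move=> p _; rewrite lee_fin kernelE.
move: (sphere_weight v p.2) (weight_ge0 v p.2) (weight_le v p.2) => w w_ge0 w_le.
rewrite normrM [leRHS]normrM [X in _ <= _ * X]normrM mulrCA ler_wpM2l//.
by rewrite !ger0_norm// expR_ge0.
Qed.

(** The transform of a convolution is a product: [kernelE] trades [expR (dotp v y)] for the
    exponential at the point of the sphere, and the translation in [y] then separates the
    variables. *)
Lemma sphere_mean_transform (k : 'rV[R]_n -> R) v :
  leb.-integrable setT (EFin \o k) -> bounded_support k ->
  (\int[leb]_y \int[leb]_z (k (pt y z) * expR (dotp v y) * \1_B z)%:E =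
   (\int[leb]_x (k x * expR (dotp v x)) * \int[leb]_z sphere_weight v z)%:E)%E.
Proof.
move=> ik bk; have ie := integrable_expR_dotp v bk ik.
have iF := integrable_kernel v ik bk.
rewrite (@Fubini _ _ _ _ _ leb leb _ iF).
transitivity (\int[leb]_z
    ((\int[leb]_x (k x * expR (dotp v x))) * sphere_weight v z)%:E)%E.
  apply: eq_integral => z _; under eq_integral => y _ do rewrite /= kernelE.
  have it := integrable_translation (r *: normalize z) ie.
  rewrite EFinM -(Rintegral_translation (r *: normalize z) ie).
  rewrite fineK; last exact: integrable_fin_num.
  by rewrite -[RHS]integralZr.
have iw := integrable_weight v.
under eq_integral => z _ do rewrite EFinM.
rewrite integralZl// EFinM; congr (_ * _)%E; rewrite fineK//.
exact: integrable_fin_num.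
Qed.

(** Only centers with [enorm y <= rho] contribute. There the exponential is at most [expR M], and
    the means of [|k|] over all centers add up to [leb B] times the integral of [|k|]. *)
Lemma sphere_mean_growth (k : 'rV[R]_n -> R) v rho M :
  leb.-integrable setT (EFin \o k) -> bounded_support k ->
  {ae leb, forall y, rho < enorm y -> (\int[leb]_(z in B) (k (pt y z))%:E = 0)%E} ->
  (forall y, enorm y <= rho -> dotp v y <= M) ->
  `|\int[leb]_x (k x * expR (dotp v x))| * \int[leb]_z sphere_weight v z <=
  expR M * (fine (leb B) * \int[leb]_x `|k x|).
Proof.
move=> ik bk k0 vM.
have mk : measurable_fun setT k by apply/measurable_EFinP; exact: measurable_int ik.
have I0 : 0 <= \int[leb]_z sphere_weight v z by exact: Rintegral_ge0.
have iF := integrable_kernel v ik bk.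
rewrite -[X in _ * X <= _]ger0_norm// -normrM -lee_fin -abse_EFin.
rewrite -sphere_mean_transform//.
have mF := measurable_fubini_F iF.
apply: le_trans (le_abse_integral leb measurableT mF) _.
have mabs : measurable_fun setT (fun x => `|k x|%:E).
  by apply/measurable_EFinP; exact: measurableT_comp.
have mkB y : measurable_fun setT (fun z => k (pt y z) * \1_B z).
  apply: measurable_funM; last first.
    by apply: measurable_indic; exact: measurable_punctured_ball.
  by apply: measurableT_comp => //; exact: measurable_dilate_normalize.
have mG : measurable_fun setT (fun y => \int[leb]_z (`|k (pt y z)| * \1_B z)%:E)%E.
  have /measurable_int mT := integrable_sphere_mean r (integrable_norm ik).
  apply: (measurable_fun_fubini_tonelli_F _ mT) => p.
  by rewrite /= lee_fin mulr_ge0.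
have G0 y : (0 <= \int[leb]_z (`|k (pt y z)| * \1_B z)%:E)%E.
  by apply: integral_ge0 => z _; rewrite lee_fin mulr_ge0.
apply: (@le_trans _ _ (\int[leb]_y
    ((expR M)%:E * \int[leb]_z (`|k (pt y z)| * \1_B z)%:E))%E).
  apply: ae_ge0_le_integral => //.
  - exact: measurableT_comp.
  - by move=> y _; rewrite mule_ge0// lee_fin expR_ge0.
  - exact: emeasurable_funM.
  apply: filterS2 (ae_integrable_sphere_mean r ik) k0 => y iy ky _.
  have [yr|yr] := leP (enorm y) rho; last first.
    rewrite [X in (`|X| <= _)%E](_ : _ = 0%E); last first.
      rewrite /fubini_F; under eq_integral => z _ do rewrite /= mulrAC EFinM.
      have /integrable_indicE iB := iy.
      by rewrite integralZr// integral_indicE ky// mul0e.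
    by rewrite abse0 mule_ge0// lee_fin expR_ge0.
  rewrite /fubini_F/=; apply: le_trans (le_abse_integral _ _ _) _ => //.
    apply/measurable_EFinP; under eq_fun do rewrite mulrAC.
    exact: measurable_funM.
  have mabsB : measurable_fun setT (fun z => (`|k (pt y z)| * \1_B z)%:E).
    apply/measurable_EFinP; under eq_fun => z do
      rewrite -[\1_B z]ger0_norm// -normrM.
    exact: measurableT_comp.
  rewrite -ge0_integralZl//.
  apply: ge0_le_integral => //.
  - apply: measurableT_comp => //; apply/measurable_EFinP.
    under eq_fun do rewrite mulrAC.
    exact: measurable_funM.
  - exact: emeasurable_funM.
  - move=> z _; rewrite -EFinM abse_EFin lee_fin mulrAC normrM mulrC normrM.
    rewrite (ger0_norm (indic_ge0 z)) ger0_norm ?expR_ge0// ler_wpM2r ?mulr_ge0//.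
    by rewrite ler_expR vM.
rewrite ge0_integralZl//.
under eq_integral => y _ do under eq_integral => z _ do rewrite EFinM.
rewrite (@ge0_integral_sphere_mean _ _ r (fun x => `|k x|%:E))//.
rewrite EFinM lee_pmul2l// ?lte_fin ?expR_gt0//.
rewrite EFinM fineK; last by rewrite ge0_fin_numE// punctured_ball_lty.
rewrite fineK//; apply: integrable_fin_num => //.
exact: integrable_norm.
Qed.

(** It suffices to integrate over a cube of points whose directions are almost opposite to [v]; the
    shift [xi] costs a factor that does not depend on [N]. *)
Lemma sphere_weight_ge v xi eps : 0 < enorm v -> 0 < eps ->
  exists2 c, 0 < c & forall N : nat, c * expR (N%:R * (r * enorm v - eps)) <=
    \int[leb]_z sphere_weight (N%:R *: v + xi) z.
Proof.
move=> v0 e0; have [a [dl [dl0 cap]]] := cap_box v0 (divr_gt0 e0 r0).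
exists ((dl *+ 2) ^+ n * expR (- (r * enorm xi))).
  by rewrite mulr_gt0 ?expR_gt0// exprn_gt0// mulrn_wgt0.
move=> N; rewrite -mulrA -expRD mulrC.
set X := expR _; set D := [set z : 'rV[R]_n | forall i, `|z ord0 i - a ord0 i| < dl].
have mD : measurable D by exact: measurable_box.
have lebD : (leb : {measure set _ -> \bar R}) D = ((dl *+ 2) ^+ n)%:E.
  by apply: lebesgue_rV_box; exact: ltW.
have iD : leb.-integrable setT (EFin \o \1_D).
  apply/integrableP; split; first exact/measurable_EFinP/measurable_indic.
  have D_ge0 z : 0 <= \1_D z :> R by rewrite indicE.
  under eq_integral do rewrite /= ger0_norm//.
  by rewrite integral_indic// setIT lebD ltry.
have -> : (dl *+ 2) ^+ n = \int[leb]_z \1_D z.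
  by rewrite /Rintegral integral_indic// setIT lebD.
rewrite -RintegralZl//; apply: le_Rintegral => //.
- exact: integrable_scale.
move=> z _; rewrite [\1_D z]indicE;
have [/set_mem/cap[Bz vz]|_] := boolP (z \in D); last first.
  by rewrite mulr0 weight_ge0.
rewrite mulr1 /sphere_weight indicE mem_set// mulr1 /X ler_expR dotpDl dotpZl.
rewrite [leLHS]addrC [leRHS]mulrDr.
have /andP[z0 _] := Bz.
apply: lerD.
  rewrite mulrCA ler_wpM2l// mulNr -mulrN.
  have -> : r * enorm v - eps = r * (enorm v - eps / r).
    by rewrite mulrBr mulrCA divff ?mulr1// gt_eqF.
  by rewrite ler_wpM2l ?(ltW r0)//; lra.
rewrite mulNr lerN2 ler_wpM2l ?(ltW r0)//.
by rewrite (le_trans (dotp_le_enorm _ _))// enorm_normalize ?mulr1.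
Qed.

(** Quotient of the two previous bounds: by Cauchy-Schwarz the numerator grows at rate
    [rho * enorm v], and the denominator at least at rate [r * enorm v - eps]. *)
Lemma laplace_growth (k : 'rV[R]_n -> R) v xi rho eps :
  leb.-integrable setT (EFin \o k) -> bounded_support k ->
  {ae leb, forall y, rho < enorm y -> (\int[leb]_(z in B) (k (pt y z))%:E = 0)%E} ->
  0 < enorm v -> 0 < eps ->
  exists C, forall N : nat,
    `|\int[leb]_x (k x * expR (dotp xi x) * expR (N%:R * dotp v x))| <=
    C * expR (N%:R * ((rho - r) * enorm v + eps)).
Proof.
move=> ik bk k0 v0 e0; have [c c0 hc] := sphere_weight_ge xi v0 e0.
pose L := fine (leb B) * \int[leb]_x `|k x|.
exists (expR (enorm xi * rho) * L / c) => N.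
have h := @sphere_mean_growth k (N%:R *: v + xi) rho
  (N%:R * (enorm v * rho) + enorm xi * rho) ik bk k0.
have {}h := h _; rewrite -/L in h.
have {h} := h _; under eq_Rintegral => x _ do
  rewrite dotpDl dotpZl addrC expRD mulrA.
move=> h.
have {h} /h : forall y : 'rV[R]_n, enorm y <= rho ->
    dotp (N%:R *: v + xi) y <= N%:R * (enorm v * rho) + enorm xi * rho.
  move=> y yr; rewrite dotpDl dotpZl; apply: lerD.
    rewrite ler_wpM2l// (le_trans (dotp_le_enorm _ _))// ler_wpM2l//.
    exact: enorm_ge0.
  by rewrite (le_trans (dotp_le_enorm _ _))// ler_wpM2l// enorm_ge0.
set I := `| _ | => h.
have : I * (c * expR (N%:R * (r * enorm v - eps))) <=
    expR (N%:R * (enorm v * rho) + enorm xi * rho) * L.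
  by apply: le_trans h; apply: ler_wpM2l; [exact: normr_ge0|exact: hc].
set E1 := expR (N%:R * _); have E10 : 0 < E1 by exact: expR_gt0.
rewrite -ler_pdivlMr ?mulr_gt0// => h1; apply: le_trans h1 _.
rewrite le_eqVlt; apply/orP; left; apply/eqP.
have -> : expR (N%:R * (enorm v * rho) + enorm xi * rho) =
  expR (enorm xi * rho) * expR (N%:R * ((rho - r) * enorm v + eps)) * E1.
  by rewrite /E1 -!expRD; congr expR; ring.
have E1n : E1 != 0 by rewrite gt_eqF.
have cn : c != 0 by rewrite gt_eqF.
move: (expR _) (expR _) => p q; field; exact/andP.
Qed.

Lemma sphere_mean_halfspace_ae0 (k : 'rV[R]_n -> R) v rho :
  leb.-integrable setT (EFin \o k) -> bounded_support k ->
  {ae leb, forall y, rho < enorm y -> (\int[leb]_(z in B) (k (pt y z))%:E = 0)%E} ->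
  (rho - r) * enorm v < 1 ->
  {ae leb, forall x, 1 < dotp v x -> k x = 0}.
Proof.
move=> ik bk k0 v1.
have [v0|v0] := eqVneq (enorm v) 0.
  by apply: aeW => x; rewrite (enorm0_eq0 v0) dotp0 ltr10.
have {}v0 : 0 < enorm v by rewrite lt_neqAle eq_sym v0 enorm_ge0.
have mD : measurable [set x | 1 < dotp v x].
  exact: (measurable_lt_fun 1 (measurable_dotp v)).
suff : laplace_null leb (k \_ [set x | 1 < dotp v x]).
  move=> /laplace_null_ae0; apply: filterS => x + vx.
  by rewrite patchE mem_set.
split; [exact: bounded_support_patch|exact: integrable_patch|] => xi.
rewrite patchME -Rintegral_mkcond.
have [M vM] := bounded_support_dotp_le v bk.
(* Half of the gap, so that the growth rate stays below the threshold 1 of the half-space. *)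
pose eps := (1 - (rho - r) * enorm v) / 2.
have e0 : 0 < eps by rewrite divr_gt0// subr_gt0.
have [C hC] := laplace_growth xi ik bk k0 v0 e0.
apply: (@laplace_tail _ _ _ leb (fun x => k x * expR (dotp xi x)) (dotp v) M C
  ((rho - r) * enorm v + eps) 1) => //.
- exact: integrable_expR_dotp.
- exact: measurable_dotp.
- by move=> x; rewrite mulf_eq0 negb_or => /andP[/vM].
- by rewrite /eps; lra.
Qed.

End sphere_mean_growth.

(** * The uniqueness theorem *)

Lemma rational_halfspace (R : realType) n (d : R) (x : 'rV[R]_n) :
  0 < d -> d < enorm x -> exists q : 'rV[rat]_n,
  d * enorm (map_mx ratr q : 'rV[R]_n) < 1 /\ 1 < dotp (map_mx ratr q) x.
Proof.
move=> d0 dx; set s := enorm x; have s0 : 0 < s by exact: lt_trans dx.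
(* [c *: x] satisfies both inequalities exactly when [c] lies strictly between these two numbers;
   the midpoint leaves room to move to a rational vector. *)
pose c := ((s * s)^-1 + (d * s)^-1) / 2.
have ss : (s * s)^-1 < (d * s)^-1 by rewrite ltf_pV2 ?posrE ?mulr_gt0// ltr_pM2r.
have c0 : 0 < c by rewrite divr_gt0// addr_gt0// invr_gt0 mulr_gt0.
have css : 1 < c * (s * s).
  by rewrite -ltr_pdivrMr ?mulr_gt0// mul1r /c; lra.
have cds : c * (d * s) < 1.
  by rewrite -ltr_pdivlMr ?mulr_gt0// mul1r /c; lra.
(* A perturbation of norm at most [th] uses up at most half of the slack in each inequality. *)
pose th := Num.min ((1 - c * (d * s)) / (2 * d)) ((c * (s * s) - 1) / (2 * s)).
have th0 : 0 < th by rewrite lt_min !divr_gt0 ?mulr_gt0 ?subr_gt0.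
have th1 : d * th < 1 - c * (d * s).
  apply: (@le_lt_trans _ _ ((1 - c * (d * s)) / 2)); last by lra.
  rewrite mulrC -ler_pdivlMr// -mulrA -invfM.
  by rewrite /th ge_min lexx.
have th2 : th * s < c * (s * s) - 1.
  apply: (@le_lt_trans _ _ ((c * (s * s) - 1) / 2)); last by lra.
  rewrite -ler_pdivlMr// -mulrA -invfM.
  by rewrite /th ge_min lexx orbT.
pose eta := th / n.+1%:R.
have eta0 : 0 < eta by rewrite divr_gt0.
have /fin_all_exists[p hp] (i : 'I_n) :
    exists a : rat, `|ratr a - c * x ord0 i| <= eta.
  have /rat_in_itvoo[a] : c * x ord0 i - eta < c * x ord0 i + eta by lra.
  by rewrite in_itv/= => /andP[? ?]; exists a; rewrite ler_norml; apply/andP; split; lra.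
pose q : 'rV[rat]_n := \row_i p i; pose v : 'rV[R]_n := map_mx ratr q.
exists q; rewrite -/v.
have vE : v = c *: x + (v - c *: x) by rewrite addrC subrK.
have hv : enorm (v - c *: x) <= th.
  apply: (@le_trans _ _ (n%:R * eta)).
    by apply: enorm_le_coor => [|i]; [exact: ltW|rewrite !mxE hp].
  by rewrite mulrCA ler_piMr ?(ltW th0)// ler_pdivrMr// mul1r ler_nat.
split.
  apply: (@le_lt_trans _ _ (d * (c * s + th))).
    rewrite ler_pM2l// vE (le_trans (enorm_triangle _ _))//.
    by rewrite enormZ ?(ltW c0)// lerD2l.
  by rewrite mulrDr mulrCA; lra.
rewrite vE dotpDl dotpZl dotpxx -/s expr2.
have := dotp_ge_enorm (v - c *: x) x; rewrite -/s.
have : enorm (v - c *: x) * s <= th * s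
  by apply: ler_wpM2r => //; exact: ltW.
lra.
Qed.

(** * Integrability of the functions of the class *)

Section L2c.
Context (R : realType) (n : nat) (d r : R).
Hypothesis r0 : 0 < r.
Local Notation leb := (@lebesgue_rV R n).

Lemma measurable_annulus : measurable (annulus d r : set 'rV[R]_n).
Proof.
rewrite (_ : annulus d r = setT `&` @enorm R n @^-1` `]d, r[%classic).
  exact: measurable_enorm.
by rewrite setTI; apply/seteqP; split => x; rewrite /annulus/= in_itv.
Qed.

Lemma L2c_ae0 (f : 'rV[R]_n -> R) : L2c (annulus d r) f ->
  {ae leb, forall x, ~ annulus d r x -> f x = 0}.
Proof.
move=> [_ [K [_ KD fK]]]; apply: filterS fK => x fx Dx.
by apply: fx => /KD.
Qed.

(** Almost everywhere [|f|] is at most the indicator of the annulus plus [f ^+ 2], and the annulus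
    has finite measure. *)
Lemma L2c_integrable (f : 'rV[R]_n -> R) : L2c (annulus d r) f ->
  leb.-integrable setT (EFin \o f).
Proof.
move=> fL; have f0 := L2c_ae0 fL.
have [fL2 _] := fL.
have mf : measurable_fun setT f by have := sub_Lfun_mfun fL2; rewrite inE.
have if2 := Lfun2_integrable_sqr fL2.
have mA := measurable_annulus.
have A_ge0 x : 0 <= \1_(annulus d r) x :> R by rewrite indicE.
have iA : leb.-integrable setT (EFin \o \1_(annulus d r)).
  apply/integrableP; split; first exact/measurable_EFinP/measurable_indic.
  under eq_integral do rewrite /= ger0_norm//.
  rewrite integral_indic// setIT.
  by apply: (@lebesgue_rV_bounded _ _ _ r) => //; [exact: ltW|move=> x /andP[]].
have iS := integrableD measurableT iA if2.
apply/integrableP; split; first exact/measurable_EFinP.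
have /integrableP[mS] := iS; apply: le_lt_trans.
apply: ae_ge0_le_integral => //.
- by apply: measurableT_comp => //; exact/measurable_EFinP.
- exact: measurableT_comp.
apply: filterS f0 => x fx _ /=.
rewrite lee_fin [leRHS]ger0_norm ?addr_ge0 ?sqr_ge0//.
rewrite indicE; have [xA|/negP xA] := boolP (x \in _).
  rewrite [X in X + _](_ : _ = 1)// -(@real_normK _ (f x)) ?num_real//.
  by have := sqr_ge0 (`|f x| - 1); have := normr_ge0 (f x); nra.
by rewrite fx ?normr0 ?add0r ?sqr_ge0// => Ax; apply: xA; rewrite inE.
Qed.

End L2c.

Unset Implicit Arguments.

Theorem theorem4p18 (R : realType) (n : nat) (d r : R)
    (d_gt0 : 0 < d) (d_lt_r : d < r) (f g : 'rV[R]_n -> R)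
    (f_L2c : L2c (annulus d r) f) (g_L2c : L2c (annulus d r) g)
    (Rf_eq_Rg : {ae lebesgue_rV, forall y : 'rV[R]_n,
       annulus (d + r) (2 * r) y ->
       spherical_transform r f y = spherical_transform r g y}) :
  {ae lebesgue_rV, forall x : 'rV[R]_n, f x = g x}.
Proof.
have r0 : 0 < r by exact: lt_trans d_lt_r.
have f0 := L2c_ae0 f_L2c; have g0 := L2c_ae0 g_L2c.
(* In dimension 0 the factor [n%:R] of the surface measure vanishes and cannot be cancelled, but the
   annulus is empty. *)
have [n0|n0] := eqVneq n 0%N.
  have annulus0 (x : 'rV[R]_n) : ~ annulus d r x.
    case/andP; rewrite /enorm big1 ?sqrtr0 => [/(lt_trans d_gt0)|i _].
      by rewrite ltxx.
    by have := ltn_ord i; rewrite {2}n0.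
  by apply: filterS2 f0 g0 => x fx gx; rewrite fx ?gx.
have iF := L2c_integrable r0 f_L2c; have iG := L2c_integrable r0 g_L2c.
have mf : measurable_fun setT f by apply/measurable_EFinP; exact: measurable_int iF.
have mg : measurable_fun setT g by apply/measurable_EFinP; exact: measurable_int iG.
have mA := @measurable_annulus R n d r.
pose A : set 'rV[R]_n := annulus d r.
(* [f - g] vanishes off the annulus only almost everywhere; the truncation gives the pointwise
   [bounded_support]. *)
pose k := (fun x => f x - g x) \_ A.
have ik : lebesgue_rV.-integrable setT (EFin \o k).
  apply: integrable_patch => //; exact: (integrableB measurableT iF iG).
have mk : measurable_fun setT k by apply/measurable_EFinP; exact: measurable_int ik.
have bk : bounded_support k.
  exists r => x; rewrite /k patchE; case: ifPn => [/set_mem/andP[_ xr] _ i|_].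
    exact: le_trans (coor_le_enorm _ _) (ltW xr).
  by rewrite eqxx.
have ae_k : {ae lebesgue_rV, forall x, f x - g x - k x = 0}.
  apply: filterS2 f0 g0 => x fx gx; rewrite /k patchE.
  case: ifPn => [_|/negP xA]; first by rewrite subrr.
  have nA : ~ A x by move=> Ax; apply: xA; rewrite inE.
  by rewrite fx ?gx// !subr0.
have mB := @measurable_punctured_ball R n.
have k_mean : {ae lebesgue_rV, forall y : 'rV[R]_n, d + r < enorm y ->
    (\int[lebesgue_rV]_(z in @punctured_ball R n)
       (k (dilate r y (normalize z)))%:E = 0)%E}.
  (* Spheres are null sets, so replacing [f - g] by [k] inside surface integrals is legitimate only
     for almost every center. *)
  have mh : measurable_fun setT (fun x => f x - g x - k x).
    by apply: measurable_funB => //; exact: measurable_funB.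
  have h_mean := ae0_sphere_mean r mh ae_k.
  have fg_mean : {ae lebesgue_rV, forall y : 'rV[R]_n,
      annulus (d + r) (2 * r) y ->
      (\int[lebesgue_rV]_(z in @punctured_ball R n)
         (f (dilate r y (normalize z)) - g (dilate r y (normalize z)))%:E = 0)%E}.
    (* For almost every center both integrals are finite, so that the equality of extended reals can
       be subtracted. *)
    apply: filterS3 (ae_integrable_sphere_mean r iF)
      (ae_integrable_sphere_mean r iG) Rf_eq_Rg => y ify igy fgy yY.
    have {yY} := fgy yY; rewrite !integral_sphere_measure//.
    have c0 : `|r| ^+ n.-1 * n%:R != 0.
      by rewrite mulf_neq0 ?expf_neq0 ?normr_eq0 ?gt_eqF// ltr0n lt0n.
    move=> /(congr1 (fun t => ((`|r| ^+ n.-1 * n%:R)^-1)%:E * t)%E).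
    rewrite !muleA -!EFinM mulVf// !mul1e => fg.
    under eq_integral do rewrite EFinB.
    rewrite integralB// fg subee//; exact: (integrable_fin_num mB igy).
  have ifg : lebesgue_rV.-integrable setT (EFin \o (fun x => f x - g x)).
    exact: (integrableB measurableT iF iG).
  have ae_k_eq : {ae lebesgue_rV, forall y : 'rV[R]_n,
      (\int[lebesgue_rV]_(z in @punctured_ball R n)
         (k (dilate r y (normalize z)))%:E =
       \int[lebesgue_rV]_(z in @punctured_ball R n)
         (f (dilate r y (normalize z)) - g (dilate r y (normalize z)))%:E)%E}.
    apply: filterS3 (ae_integrable_sphere_mean r ifg)
      (ae_integrable_sphere_mean r ik) h_mean => y ify iky.
    under eq_integral do rewrite EFinB.
    rewrite integralB//.
    have /fineK <- := integrable_fin_num mB ify.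
    have /fineK <- := integrable_fin_num mB iky.
    by rewrite -EFinB => -[] /eqP; rewrite subr_eq0 => /eqP ->.
  apply: filterS2 ae_k_eq fg_mean => y k_eq fgy dry.
  (* Beyond [2 * r] there is no data, but the points of the sphere have norm at least
     [enorm y - r >= r], so the sphere misses the annulus. *)
  have [ry|ry] := leP (2 * r) (enorm y).
    apply: integral0_eq => z /andP[z0 _]; rewrite /k patchE ifF//.
    apply/negP; rewrite inE => /andP[_]; apply/negP; rewrite -leNgt.
    have yE : y = dilate r y (normalize z) + - (r *: normalize z).
      by rewrite /dilate addrK.
    have := enorm_triangle (dilate r y (normalize z)) (- (r *: normalize z)).
    rewrite -yE enormN enormZ ?(ltW r0)// enorm_normalize// mulr1.
    by move: ry; lra.
  have {}fgy : (\int[lebesgue_rV]_(z in @punctured_ball R n)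
      (f (dilate r y (normalize z)) - g (dilate r y (normalize z)))%:E = 0)%E.
    by apply: fgy; rewrite /annulus/= dry ry.
  by rewrite k_eq.
have half q : d * enorm (map_mx ratr q : 'rV[R]_n) < 1 ->
    {ae lebesgue_rV, forall x : 'rV[R]_n, 1 < dotp (map_mx ratr q) x -> k x = 0}.
  move=> dq; apply: (sphere_mean_halfspace_ae0 r0 ik bk k_mean).
  by rewrite addrK.
(* The rational vectors are enumerated by [unpickle], which turns the exceptional sets into a
   countable union. *)
have {half} all_half : {ae lebesgue_rV, forall x : 'rV[R]_n, forall j : nat,
    forall q : 'rV[rat]_n, unpickle j = Some q ->
    d * enorm (map_mx ratr q : 'rV[R]_n) < 1 ->
    1 < dotp (map_mx ratr q) x -> k x = 0}.
  apply: ae_foralln => j; case: (unpickle j) => [q|]; last by apply: aeW.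
  have [dq|dq] := ltP (d * enorm (map_mx ratr q : 'rV[R]_n)) 1.
    by apply: filterS (half q dq) => x kx _ [<-].
  by apply: aeW => x _ [<-]; rewrite ltNge dq.
apply: filterS2 all_half ae_k => x hx fgx.
suff kx : k x = 0 by move: fgx; rewrite kx subr0 => /eqP; rewrite subr_eq0 => /eqP.
have [xA|xA] := boolP (x \in A); last by rewrite /k patchE (negbTE xA).
have /andP[dx _] := set_mem xA.
have [q [dq qx]] := rational_halfspace d_gt0 dx.
exact: (hx (pickle q) q (pickleK q)).
Qed.
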